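(* Let $A$ be a stark connected reduced order with degree map $d_A\colon\mu\to\Gamma$ (where $\mu=\mu(A)$, $\Gamma=\Gamma(A)$), and let $G$ be a finite abelian group. Let $M$ be the set of matrices $\begin{pmatrix}\alpha & s\\ t&\sigma\end{pmatrix}$ with $\alpha\in\operatorname{Aut}(A)$, $s\in\operatorname{Hom}(G,\mu)$, $t\in\operatorname{Hom}(\Gamma,G)$, $\sigma\in\operatorname{Aut}(G)$, equipped with the multiplication $$\begin{pmatrix}\alpha_1 & s_1\\ t_1&\sigma_1\end{pmatrix}\begin{pmatrix}\alpha_2 & s_2\\ t_2&\sigma_2\end{pmatrix}=\begin{pmatrix}\alpha_1\alpha_2+s_1t_2 & \alpha_1s_2+s_1\sigma_2\\ t_1\alpha_2+\sigma_1t_2 & t_1d_As_2+\sigma_1\sigma_2\end{pmatrix},$$ where: $\alpha_1\alpha_2$ is composition in $\operatorname{Aut}(A)$ and $s_1t_2=s_1\circ t_2\in\operatorname{Hom}(\Gamma,\mu)$; $\alpha_1s_2=\alpha_1|_{\mu}\circ s_2$, $s_1\sigma_2=s_1\circ\sigma_2$, and their sum is taken in the group $\operatorname{Hom}(G,\mu)$; $t_1\alpha_2=t_1\circ\alpha_{2,\Gamma}$, $\sigma_1t_2=\sigma_1\circ t_2$, summed in $\operatorname{Hom}(\Gamma,G)$; and $t_1d_As_2=t_1\circ d_A\circ s_2$ and $\sigma_1\sigma_2$ are added in the ring $\operatorname{End}(G)$. Then: (i) $M$ is a group; (ii) there is a group isomorphism $M\xrightarrow{\sim}\operatorname{Aut}(A[G])$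 such that the matrix $\begin{pmatrix}\alpha & s\\ t&\sigma\end{pmatrix}$ acts on the ring $A[G]$ by $$x\cdot g\;\longmapsto\;\big(\alpha(x)\,s(g)\big)\cdot\big(t(\gamma)\,\sigma(g)\big)$$ for all $g\in G$, $\gamma\in\Gamma$ and $x\in A_\gamma$ (extended additively).
   Context: All rings have a unit element. An order is a commutative ring whose additive group is isomorphic to $\mathbb{Z}^n$ for some $n\geq0$; it is reduced if it has no non-zero nilpotents, connected if it has exactly two idempotents, and stark if there do not exist a ring $B$ and a non-trivial group $H$ with it isomorphic to $B[H]$. $\mu(A)$ is the (finite) group of roots of unity of $A$. A grading of a commutative ring $R$ is a pair $(\Delta,(R_\delta)_{\delta\in\Delta})$ with $\Delta$ a multiplicatively written abelian group and $R_\delta$ additive subgroups of $R$ such that $R_\gamma R_\delta\subset R_{\gamma\delta}$ for all $\gamma,\delta$ and the natural map $\bigoplus_\delta R_\delta\to R$ is bijective. For a homomorphism $f\colon\Delta\to E$, the pushforward grading is $(E,(S_\epsilon)_\epsilon)$ with $S_\epsilon=\sum_{\delta\in f^{-1}(\epsilon)}R_\delta$. A grading $(\Gamma,(R_\gamma))$ is universal if for every grading $(E,\mathcal{S})$ of $R$ there is a unique homomorphism $f\colon\Gamma\to E$ whose pushforward is $\mathcal{S}$. Every reduced order has a universal grading, unique up to unique isomorphism, with finite group, denoted $(\Gamma(A),(A_\gamma)_\gamma)$. For a connected reduced order $A$ each $\zeta\in\mu(A)$ lies in $A_\gamma$ for a unique $\gamma$; the degree map $d_A\colon\mu(A)\to\Gamma(A)$,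 $\zeta\mapsto\gamma$, is a group homomorphism. Each $\alpha\in\operatorname{Aut}(A)$ induces an automorphism $\alpha_\Gamma$ of $\Gamma$ characterized by $\alpha(A_\gamma)=A_{\alpha_\Gamma(\gamma)}$ for all $\gamma$ with $A_\gamma\ne 0$. Groups $\operatorname{Hom}(X,Y)$ of homomorphisms between abelian groups are written additively (addition is pointwise group operation in $Y$). For $\alpha\in\operatorname{Aut}(A)$ and $h\in\operatorname{Hom}(\Gamma,\mu)$, $\alpha+h$ denotes the map $A\to A$ given on homogeneous elements by $x\mapsto\alpha(x)\cdot h(\gamma)$ for $x\in A_\gamma$ (extended additively); for $A$ stark this is again an element of $\operatorname{Aut}(A)$. Elements of the group ring $A[G]$ are sums of $x\cdot g$ with $x\in A$, $g\in G$. *)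

(* Defs.v *)
From HB Require Import structures.
From mathcomp Require Import all_boot all_order all_algebra all_fingroup.
From Stdlib Require Import ClassicalEpsilon.
Set Implicit Arguments. Unset Strict Implicit. Unset Printing Implicit Defensive.
Import GRing.Theory.
Local Open Scope ring_scope.

Definition zhom (U V : zmodType) (f : U -> V) : Prop :=
  forall x y, f (x + y) = f x + f y.
Definition zaut (U : zmodType) (f : U -> U) : Prop := zhom f /\ bijective f.

Definition ring_aut (R : pzRingType) (f : R -> R) : Prop :=
  [/\ forall x y, f (x + y) = f x + f y,
      forall x y, f (x * y) = f x * f y,
      f 1 = 1 & bijective f].

Definition is_order (A : comPzRingType) : Prop :=
  exists (n : nat) (f : A -> 'rV[int]_n), zhom f /\ bijective f.
Definition reduced (A : comPzRingType) : Prop :=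
  forall (x : A) (n : nat), x ^+ n = 0 -> x = 0.
Definition connected (A : comPzRingType) : Prop :=
  (0 : A) <> 1 /\ forall e : A, e * e = e -> e = 0 \/ e = 1.

(* elements of R[H] are the functions H -> R; op is the group law of H *)
Definition gmul (H : finType) (op : H -> H -> H) (R : pzRingType)
  (u v : {ffun H -> R}) : {ffun H -> R} :=
  [ffun h => \sum_(a : H) \sum_(b : H | op a b == h) u a * v b].
Definition gone (H : finType) (e : H) (R : pzRingType) : {ffun H -> R} :=
  [ffun h => if h == e then 1 else 0].
Definition gelt (H : finType) (R : pzRingType) (x : R) (g : H) : {ffun H -> R} :=
  [ffun h => if h == g then x else 0].

Definition iso_group_ring (A : pzRingType) (B : pzRingType) (H : finGroupType)
  (phi : A -> {ffun H -> B}) : Prop :=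
  [/\ forall x y, phi (x + y) = phi x + phi y,
      forall x y, phi (x * y) = gmul (@mulg H) (phi x) (phi y),
      phi 1 = gone (1%g : H) B & bijective phi].

Definition stark (A : comPzRingType) : Prop :=
  ~ exists (B : pzRingType) (H : finGroupType) (phi : A -> {ffun H -> B}),
      (1 < #|H|)%N /\ iso_group_ring phi.

Definition gr_aut (A : comPzRingType) (G : finZmodType)
  (F : {ffun G -> A} -> {ffun G -> A}) : Prop :=
  [/\ forall u v, F (u + v) = F u + F v,
      forall u v, F (gmul (@GRing.add G) u v) = gmul (@GRing.add G) (F u) (F v),
      F (gone (0 : G) A) = gone (0 : G) A & bijective F].

Definition is_grading (R : pzRingType) (D : zmodType) (S : D -> R -> Prop) : Prop :=
  [/\ (forall d, S d 0 /\ forall x y, S d x -> S d y -> S d (x - y)),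
      (forall d e x y, S d x -> S e y -> S (d + e) (x * y)),
      (forall x : R, exists (r : seq D) (y : D -> R),
          (forall d, S d (y d)) /\ x = \sum_(d <- r) y d) &
      (forall (r : seq D) (y : D -> R), uniq r -> (forall d, S d (y d)) ->
          \sum_(d <- r) y d = 0 -> forall d, d \in r -> y d = 0)].

Definition pushforward (R : pzRingType) (Gam : finZmodType) (S : Gam -> R -> Prop)
  (E : zmodType) (f : Gam -> E) (e : E) (x : R) : Prop :=
  exists y : Gam -> R, (forall g, S g (y g)) /\ x = \sum_(g : Gam | f g == e) y g.

Definition universal_grading (R : pzRingType) (Gam : finZmodType)
  (S : Gam -> R -> Prop) : Prop :=
  is_grading S /\
  forall (E : zmodType) (T : E -> R -> Prop), is_grading T ->
    exists f : Gam -> E,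
      (zhom f /\ forall e x, T e x <-> pushforward S f e x) /\
      forall f' : Gam -> E, zhom f' -> (forall e x, T e x <-> pushforward S f' e x) ->
        forall g, f' g = f g.

Definition root_of_unity (A : comPzRingType) (z : A) : Prop :=
  exists n : nat, (0 < n)%N /\ z ^+ n = 1.

Definition hom_mu (A : comPzRingType) (G : finZmodType) (s : G -> A) : Prop :=
  (forall g, root_of_unity (s g)) /\ forall g h, s (g + h) = s g * s h.

Section Graded.
Variables (A : comPzRingType) (Gam : finZmodType) (Agr : Gam -> A -> Prop).

Definition deg (z : A) : Gam := epsilon (inhabits 0) (fun g => Agr g z).

Definition comp (x : A) : Gam -> A :=
  epsilon (inhabits (fun _ => 0))
    (fun c : Gam -> A => (forall g, Agr g (c g)) /\ x = \sum_(g : Gam) c g).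

Definition alphaG (a : A -> A) : Gam -> Gam :=
  epsilon (inhabits id)
    (fun f : Gam -> Gam => zaut f /\
       forall g, (exists x, Agr g x /\ x <> 0) ->
         forall y, Agr (f g) y <-> exists x, Agr g x /\ y = a x).

Definition add_aut (a : A -> A) (h : Gam -> A) (x : A) : A :=
  \sum_(g : Gam) a (comp x g) * h g.

Variable G : finZmodType.

Record mat := Mat { m_a : A -> A; m_s : G -> A; m_t : Gam -> G; m_sig : G -> G }.

Definition inM (m : mat) : Prop :=
  [/\ ring_aut (m_a m), hom_mu (m_s m), zhom (m_t m) & zaut (m_sig m)].

Definition mulM (m1 m2 : mat) : mat :=
  Mat (add_aut (m_a m1 \o m_a m2) (m_s m1 \o m_t m2))
      (fun g => m_a m1 (m_s m2 g) * m_s m1 (m_sig m2 g))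
      (fun c => m_t m1 (alphaG (m_a m2) c) + m_sig m1 (m_t m2 c))
      (fun g => m_t m1 (deg (m_s m2 g)) + m_sig m1 (m_sig m2 g)).

End Graded.

Definition is_group (T : Type) (P : T -> Prop) (mul : T -> T -> T) : Prop :=
  [/\ (forall x y, P x -> P y -> P (mul x y)),
      (forall x y z, P x -> P y -> P z -> mul x (mul y z) = mul (mul x y) z) &
      exists e, [/\ P e, (forall x, P x -> mul e x = x /\ mul x e = x) &
                   forall x, P x -> exists y, [/\ P y, mul x y = e & mul y x = e]]].

(* Main.v *)
(**
  Write [A[G]] for the group ring and let [(A_c)] be the universal grading. The point is
  that an automorphism [F] of [A[G]] respects degrees.

  Integrality enters through one fact: an element of a reduced order whose images under
  all homomorphisms to the complex numbers have absolute value less than 1 is zero. Give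
  an order the square norm [q x = sum_t |t x|^2], [t] ranging over all such homomorphisms;
  it is at least 1 on nonzero elements. A grading by a finite group [D] lets the dual of
  [D] act on the homomorphisms, so by Parseval [q x] is the sum of the [q x_d]. Hence
  repeatedly splitting an element along two different gradings terminates: any two
  gradings have a common refinement. Applied to the [G]-grading of [A[G]] and its pullback
  under [F], this grades [A] by [G], and universality yields [t : Gamma -> G] with [F A_c]
  contained in [A * t c]. A second use of Parseval shows that roots of unity are
  homogeneous, so [F g = s g * sigma g]. Thus [F] has the matrix form, except that [alpha]
  and [sigma] are only known to be endomorphisms.

  Invertibility comes from starkness: if [h : Gamma -> mu] and [d (h c) = c] with [c <>
  0], then an idempotent power [E] of [d o h] retracts [Gamma] onto a nontrivial subgroup
  [E Gamma], each [A_c] with [c] in [E Gamma] contains a unit depending multiplicatively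
  on [c], and [A] is a group ring over [E Gamma]. So [d o h] has no nonzero fixed point,
  and this is what makes [1 + h], [sigma], [alpha] and the matrix action bijective. The
  group axioms for [M] follow since the action on [A[G]] is faithful, multiplicative and
  onto [Aut A[G]].
*)
Require Import Defs.
From HB Require Import structures.
From mathcomp Require Import all_boot all_order all_algebra all_fingroup all_field all_character.
From Stdlib Require Import ClassicalEpsilon FunctionalExtensionality.
Set Implicit Arguments. Unset Strict Implicit. Unset Printing Implicit Defensive.
Import Order.TTheory GRing.Theory Num.Theory.
Local Open Scope ring_scope.

(* [ssrfun.comp] and [poly.root_of_unity] shadow the notions of [Defs]. *)
Local Notation hc := Defs.comp.
Local Notation root_of_unity := Defs.root_of_unity.

(** * Homomorphisms of an order to the complex numbers *)

Section Zhom.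
Variables (U V : zmodType) (f : U -> V).
Hypothesis fD : zhom f.

Lemma zhom0 : f 0 = 0.
Proof. by apply: (addrI (f 0)); rewrite -fD !addr0. Qed.

Lemma zhomN : {morph f : x / - x}.
Proof. by move=> x; apply: (addrI (f x)); rewrite -fD !subrr zhom0. Qed.

Lemma zhomB : {morph f : x y / x - y}.
Proof. by move=> x y; rewrite fD zhomN. Qed.

Lemma zhom_sum (I : Type) (r : seq I) (P : pred I) (F : I -> U) :
  f (\sum_(i <- r | P i) F i) = \sum_(i <- r | P i) f (F i).
Proof. exact: (big_morph f fD zhom0). Qed.

Lemma zhomMz (x : U) (k : int) : f (x *~ k) = f x *~ k.
Proof.
have fMn m : f (x *+ m) = f x *+ m.
  by elim: m => [|m IH]; rewrite ?mulr0n ?zhom0 // !mulrS fD IH.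
by case: k => m; [exact: fMn | rewrite NegzE !mulrNz zhomN; congr (- _); exact: fMn].
Qed.

End Zhom.

Definition rhom (R : comPzRingType) (t : R -> algC) : Prop :=
  [/\ zhom t, forall x y, t (x * y) = t x * t y & t 1 = 1].

Lemma rhomX (R : comPzRingType) (t : R -> algC) (x : R) n :
  rhom t -> t (x ^+ n) = t x ^+ n.
Proof. by case=> _ tM t1; elim: n => [|n IH]; rewrite ?expr0 // !exprS tM IH. Qed.

Section Order.
Variables (R : comPzRingType) (n : nat) (f : R -> 'rV[int]_n) (g : 'rV[int]_n -> R).
Hypotheses (fD : zhom f) (fK : cancel f g) (gK : cancel g f).

Definition zbasis (i : 'I_n) : R := g (delta_mx 0 i).

(** The regular representation in the basis [zbasis], by integer matrices acting on row vectors of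
    coordinates. *)
Definition regrep (x : R) : 'M[int]_n := \matrix_(i < n) f (zbasis i * x).

Lemma zbasis_sum x : x = \sum_i zbasis i *~ f x 0 i.
Proof.
apply: (can_inj fK); rewrite zhom_sum //; apply/rowP => j.
rewrite summxE (bigD1 j) //= zhomMz // gK -scaler_int mxE mxE !eqxx mulr1 intz.
rewrite big1 ?addr0 // => i ij.
by rewrite zhomMz // gK -scaler_int mxE mxE eq_sym (negPf ij) andbF mulr0.
Qed.

Lemma regrepD x y : regrep (x + y) = regrep x + regrep y.
Proof. by apply/row_matrixP => i; rewrite linearD /= !rowK mulrDr fD. Qed.

Lemma regrep_act z x : f (z * x) = f z *m regrep x.
Proof.
rewrite {1}[z]zbasis_sum mulr_suml zhom_sum // mulmx_sum_row; apply: eq_bigr => i _.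
by rewrite -mulrzl -mulrA mulrzl zhomMz // rowK -scaler_int intz.
Qed.

Lemma regrepM x y : regrep (x * y) = regrep x *m regrep y.
Proof. by apply/row_matrixP => i; rewrite row_mul !rowK mulrA regrep_act. Qed.

Lemma regrep1 : regrep 1 = 1%:M.
Proof. by apply/row_matrixP => i; rewrite rowK mulr1 gK row1. Qed.

Lemma regrep_inj x : regrep x = 0 -> x = 0.
Proof.
move=> x0; apply: (can_inj fK); rewrite -[x in LHS]mul1r regrep_act x0 mulmx0.
by rewrite zhom0.
Qed.

End Order.
Lemma mul_trig_diag n (S T : 'M[algC]_n) i :
  is_trig_mx S -> is_trig_mx T -> (S *m T) i i = S i i * T i i.
Proof.
move=> /is_trig_mxP hS /is_trig_mxP hT; rewrite mxE (bigD1 i) //= big1 ?addr0 // => k ki.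
by have [lt|gt|/val_inj e] := ltngtP k i;
  [rewrite hT // mulr0 | rewrite hS // mul0r | rewrite e eqxx in ki].
Qed.

Lemma char_poly_conj n (P Q A : 'M[algC]_n) :
  P *m Q = 1%:M -> char_poly (P *m A *m Q) = char_poly A.
Proof.
move=> PQ; rewrite /char_poly.
have -> : char_poly_mx (P *m A *m Q) = map_mx polyC P *m char_poly_mx A *m map_mx polyC Q.
  rewrite /char_poly_mx mulmxBr mulmxBl !map_mxM; congr (_ - _).
  by rewrite scalar_mxC -mulmxA -map_mxM PQ map_mx1 mulmx1.
rewrite !det_mulmx mulrC mulrA -det_mulmx -map_mxM.
by rewrite (mulmx1C PQ) map_mx1 det1 mul1r.
Qed.

(* A monic integer polynomial has an integer as product of its nonzero roots, which has
   absolute value at least 1. *)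
Lemma small_roots_eq0 n (p : {poly int}) (l : 'I_n -> algC) :
  map_poly intr p = \prod_(i < n) ('X - (l i)%:P) ->
  (forall i, `|l i| < 1) -> forall i, l i = 0.
Proof.
move=> pE lsmall i; apply/eqP; apply: contraT => li.
pose c := \prod_(j < n | l j != 0) - l j.
pose a := #|[pred j : 'I_n | l j == 0]|.
have c0 : c != 0 by apply/prodf_neq0 => j lj; rewrite oppr_eq0.
have cint : c \is a Num.int.
  suff -> : c = (p`_a)%:~R by rewrite intr_int.
  rewrite -coef_map /= pE (bigID (fun j => l j == 0)) /=.
  have -> : \prod_(j < n | l j == 0) ('X - (l j)%:P) = 'X^a.
    by rewrite (eq_bigr (fun=> 'X)) ?prodr_const // => j /eqP->; rewrite subr0.
  rewrite coefXnM ltnn subnn -horner_coef0 horner_prod.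
  by apply: eq_bigr => j _; rewrite !hornerE.
suff lt : `|c| < 1 by have := lt_le_trans lt (norm_intr_ge1 cint c0); rewrite ltxx.
rewrite normr_prod (bigD1 i) //= normrN.
apply: le_lt_trans (lsmall i); rewrite ler_piMr // prodr_ile1 // => j _.
by rewrite normrN normr_ge0 ltW.
Qed.

(** The regular representation is commutative, so over [algC] it can be made triangular
    simultaneously. Each diagonal entry is then a ring homomorphism, so all eigenvalues of [w] are
    small. They are the roots of an integer polynomial, hence vanish; by Cayley-Hamilton [w] is
    nilpotent, so zero. *)
Lemma small_eq0 (R : comPzRingType) (w : R) :
  is_order R -> reduced R -> (forall t : R -> algC, rhom t -> `|t w| < 1) -> w = 0.
Proof.
move=> [n [f [fD [g fK gK]]]] hred small.
pose M x := map_mx (intr : int -> algC) (regrep f g x).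
have MM x y : M (x * y) = M x *m M y by rewrite /M regrepM // map_mxM.
have MD x y : M (x + y) = M x + M y by rewrite /M regrepD // map_mxD.
(* Triangularity passes to sums, so it suffices to treat the finitely many basis elements. *)
pose As := [seq M (zbasis g i) | i : 'I_n].
have Acomm : {in As &, forall A B, comm_mx A B}.
  by move=> _ _ /mapP[i _ ->] /mapP[j _ ->]; rewrite /comm_mx -!MM mulrC.
have [P Pu /allP trigP] := cotrigonalization Acomm.
have Punit := unitarymx_unit Pu.
pose T x := P *m M x *m invmx P.
have TD : zhom T by move=> x y; rewrite /T MD mulmxDr mulmxDl.
have TM x y : T (x * y) = T x *m T y.
  by rewrite /T MM !mulmxA mulmxKV.
have Ttrig x : is_trig_mx (T x).
  rewrite [x](zbasis_sum fD fK gK) zhom_sum //; apply/is_trig_mxP => j k jk.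
  rewrite summxE big1 // => i _; rewrite zhomMz //.
  have /is_trig_mxP Ti : is_trig_mx (T (zbasis g i)).
    rewrite /T -conjumx // ; apply: trigP.
    by apply/mapP; exists i; rewrite ?mem_enum.
  by rewrite -scaler_int mxE Ti ?mulr0.
have Thom i : rhom (fun x => T x i i).
  split=> [x y|x y|]; first by rewrite TD mxE.
  - by rewrite TM mul_trig_diag.
  - by rewrite /T /M regrep1 // map_mx1 mulmx1 mulmxV // mxE eqxx.
have cE : map_poly intr (char_poly (regrep f g w)) = \prod_(i < n) ('X - (T w i i)%:P).
  by rewrite map_char_poly -char_poly_trig // char_poly_conj // mulmxV.
have l0 := small_roots_eq0 cE (fun i => small _ (Thom i)).
have {}cE : char_poly (regrep f g w) = 'X^n.
  apply: (@map_inj_poly _ _ (intr : int -> algC) intr_inj) => [|/=]; first by rewrite mulr0z.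
  rewrite cE map_polyXn (eq_bigr (fun=> 'X)) ?prodr_const ?card_ord // => i _.
  by rewrite l0 subr0.
apply: (hred w n); apply: (regrep_inj fD fK gK).
clear -cE fD fK gK.
have ME k : regrep f g (w ^+ k) = iter k (mulmx (regrep f g w)) 1%:M.
  elim: k => [|k IH]; first by rewrite expr0 regrep1.
  by rewrite exprS regrepM // IH.
(* Square matrices form a ring with evaluation of polynomials only in positive size; in size 0 all
   matrices are equal. *)
rewrite ME; case: n f g fD fK gK cE ME => [|n] f g fD fK gK cE ME; first by apply/matrixP => -[].
have := Cayley_Hamilton (regrep f g w); rewrite cE rmorphXn /= horner_mx_X => <-.
have pE k : regrep f g w ^+ k = iter k (mulmx (regrep f g w)) 1%:M.
  by elim: k => [|k IH]; rewrite ?expr0 // iterS -IH exprS.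
exact/esym/pE.
Qed.

(** * Gradings and Parseval *)

(** Classical truth value, used to carve finite types and subrings out of arbitrary propositions. *)
Definition decide (P : Prop) : bool := excluded_middle_informative P.

Lemma decideP (P : Prop) : reflect P (decide P).
Proof. by rewrite /decide; case: excluded_middle_informative => p; constructor. Qed.

(** A homomorphism is determined by its values on a basis, and each value is an eigenvalue of
    multiplication by that basis element. This leaves finitely many choices. *)
Lemma finite_homs (R : comPzRingType) : is_order R ->
  exists (I : finType) (t : I -> R -> algC),
    [/\ forall i, rhom (t i), forall i j, t i =1 t j -> i = j &
        forall s, rhom s -> exists i, t i =1 s].
Proof.
move=> [n [f [fD [g fK gK]]]].
(* Transposed, so that the row of values of a homomorphism on the basis is an eigenvector of [A i].
   It is nonzero because 1 is mapped to 1. *)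
pose A i := (map_mx (intr : int -> algC) (regrep f g (zbasis g i)))^T.
pose L := flatten [seq sval (closed_field_poly_normal (char_poly (A i))) | i : 'I_n].
have hom_ext s s' : rhom s -> rhom s' ->
    (forall i, s (zbasis g i) = s' (zbasis g i)) -> s =1 s'.
  move=> [sD _ _] [s'D _ _] eb x; rewrite (zbasis_sum fD fK gK x).
  by rewrite !zhom_sum //; apply: eq_bigr => i _; rewrite !zhomMz // eb.
have homL s i : rhom s -> s (zbasis g i) \in L.
  move=> [sD sM s1]; apply/flatten_mapP; exists i; first by rewrite mem_enum.
  case: closed_field_poly_normal => r /= rE.
  have : root (char_poly (A i)) (s (zbasis g i)).
    rewrite -eigenvalue_root_char; apply/eigenvalueP.
    exists (\row_k s (zbasis g k)).
      apply/rowP => k; rewrite !mxE -sM mulrC.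
      rewrite [X in s X](zbasis_sum fD fK gK) zhom_sum //.
      by apply: eq_bigr => j _; rewrite !mxE [RHS]zhomMz // mulrzr.
    apply/negP => /eqP /rowP v0; have := s1; rewrite (zbasis_sum fD fK gK 1).
    rewrite zhom_sum // big1 ?oner_eq0 => [/eqP|j _]; first by rewrite eq_sym oner_eq0.
    by have := v0 j; rewrite !mxE zhomMz // => ->; rewrite mul0rz.
  rewrite rE rootZ ?root_prod_XsubC // lead_coef_eq0.
  by rewrite monic_neq0 // char_poly_monic.
(* A homomorphism is encoded by the eigenvalues it takes on the basis; [I] keeps the assignments
   that some homomorphism realises. *)
pose good (c : {ffun 'I_n -> seq_sub L}) (s : R -> algC) :=
  rhom s /\ forall i, s (zbasis g i) = val (c i).
pose I := {c : {ffun 'I_n -> seq_sub L} | decide (exists s, good c s)}.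
pose t (c : I) := epsilon (inhabits (fun=> 0)) (good (val c)).
have tP c : good (val c) (t c).
  by apply: epsilon_spec; apply/decideP; exact: (valP c).
exists I, t; split=> [c|c c' tt|s hs]; first by case: (tP c).
  apply/val_inj/ffunP => i; apply: val_inj.
  by rewrite -(tP c).2 -(tP c').2.
pose c := [ffun i => SeqSub (homL s i hs)].
have Pc : decide (exists s, good c s).
  by apply/decideP; exists s; split=> // i; rewrite ffunE.
exists (exist _ c Pc); have [ht tE] := tP (exist _ c Pc).
by apply: hom_ext => // i; rewrite tE /= ffunE.
Qed.

Lemma dual_characters (D : finZmodType) :
  exists (J : finType) (chi : J -> D -> algC),
    [/\ #|J| = #|D|, forall j d e, chi j (d + e) = chi j d * chi j e,
        forall j, chi j 0 = 1, forall j d, `|chi j d| = 1 &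
        forall d e, \sum_j chi j d * (chi j e)^* = #|D|%:R *+ (d == e)].
Proof.
pose G : {group D} := [set: D]%G.
have Gab : abelian G by apply: FinRing.zmod_abelian.
have lin (j : Iirr G) : 'chi_j \is a linear_char by apply/char_abelianP.
have orth d e : \sum_(j : Iirr G) 'chi_j d * ('chi_j e)^* = #|D|%:R *+ (d == e).
  rewrite second_orthogonality_relation ?inE //.
  have -> : ('C_G[d] = G)%g.
    by apply/setIidPl/subsetP => x _; apply/cent1P; exact: FinRing.zmod_mulgC.
  by rewrite cardsT (abelian_classP _ Gab) ?inE.
have chi1 (j : Iirr G) : 'chi_j 0 = 1 :> algC by apply: lin_char1.
exists (Iirr G), (fun j d => 'chi_j d); split=> //.
(* Orthogonality at [d = e = 0] counts the characters, since each takes the value 1 at 0. *)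
- apply/eqP; rewrite -(eqr_nat algC).
  have := orth 0 0; rewrite eqxx mulr1n => <-.
  rewrite (eq_bigr (fun=> 1)) ?sumr_const // => j _.
  by rewrite chi1 conjC1 mulr1.
- by move=> j d e; rewrite -lin_charM ?inE.
- by move=> j d; rewrite normC_lin_char ?inE.
Qed.


Section Grading.
Variables (R : comPzRingType) (D : finZmodType) (S : D -> R -> Prop).
Hypothesis hS : is_grading S.

Lemma gr0 d : S d 0. Proof. by case: hS => /(_ d)[]. Qed.
Lemma grB d x y : S d x -> S d y -> S d (x - y).
Proof. by case: hS => /(_ d)[_ B] _ _ _; apply: B. Qed.
Lemma grN d x : S d x -> S d (- x).
Proof. by move=> Sx; rewrite -sub0r; apply: grB => //; apply: gr0. Qed.
Lemma grD d x y : S d x -> S d y -> S d (x + y).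
Proof. by move=> Sx Sy; rewrite -[y]opprK; apply: grB => //; apply: grN. Qed.
Lemma grM d e x y : S d x -> S e y -> S (d + e) (x * y).
Proof. by case: hS => _ M _ _; apply: M. Qed.
Lemma gr_sum d (I : Type) (r : seq I) (P : pred I) (F : I -> R) :
  (forall i, P i -> S d (F i)) -> S d (\sum_(i <- r | P i) F i).
Proof. by move=> SF; elim/big_ind: _ => //; [exact: gr0 | move=> ? ?; exact: grD]. Qed.

Lemma hc_spec x : (forall d, S d (hc S x d)) /\ x = \sum_d hc S x d.
Proof.
rewrite /hc; apply: (@epsilon_spec _ _ (fun c => (forall d, S d (c d)) /\ x = \sum_d c d)).
case: hS => _ _ /(_ x)[r [y [Sy xE]]] _.
(* The sequence [r] may repeat degrees, so its terms are collected by degree. *)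
exists (fun e => \sum_(d <- r | d == e) y d); split.
  by move=> e; apply: gr_sum => d /eqP <-.
rewrite xE (exchange_big_dep xpredT) //=; apply: eq_bigr => d _.
by rewrite (big_pred1 d) // => e; rewrite /= eq_sym.
Qed.

Lemma hcP x d : S d (hc S x d). Proof. by case: (hc_spec x). Qed.
Lemma hc_sum x : \sum_d hc S x d = x. Proof. by case: (hc_spec x). Qed.

Lemma homog_ind (P : R -> Prop) :
  (forall x y, P x -> P y -> P (x + y)) -> (forall d x, S d x -> P x) -> forall x, P x.
Proof.
move=> PD PS x; rewrite -(hc_sum x); elim/big_ind: _ => // [|d _].
  exact: PS (gr0 0).
exact: PS (hcP x d).
Qed.

Lemma gr_indep (c : D -> R) :
  (forall d, S d (c d)) -> \sum_d c d = 0 -> forall d, c d = 0.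
Proof.
case: hS => _ _ _ ind Sc c0 d.
by apply: (ind (index_enum D)) => //; rewrite ?index_enum_uniq ?mem_index_enum.
Qed.

Lemma hc_uniq (c : D -> R) x :
  (forall d, S d (c d)) -> x = \sum_d c d -> forall d, hc S x d = c d.
Proof.
move=> Sc xE d; apply/eqP; rewrite -subr_eq0; apply/eqP.
apply: (gr_indep (c := fun d => hc S x d - c d)) => [e|].
  exact: grB (hcP x e) (Sc e).
by rewrite big_split /= sumrN hc_sum -xE subrr.
Qed.

Lemma hc_homog x d : S d x -> forall e, hc S x e = if e == d then x else 0.
Proof.
move=> Sx e; apply: (hc_uniq (c := fun e => if e == d then x else 0)).
  by move=> e'; case: eqP => [->|_] //; apply: gr0.
by rewrite -big_mkcond big_pred1_eq.
Qed.

Lemma hcD d : zhom (fun x => hc S x d).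
Proof.
move=> x y; apply: (hc_uniq (c := fun d => hc S x d + hc S y d)) => [e|].
  by apply: grD; apply: hcP.
by rewrite big_split /= !hc_sum.
Qed.

Lemma hcM x y d : hc S (x * y) d = \sum_e hc S x e * hc S y (d - e).
Proof.
apply: (hc_uniq (c := fun d => \sum_e hc S x e * hc S y (d - e))) => [e|].
  apply: gr_sum => a _; rewrite -[e in S e](subrK a) [_ + a]addrC.
  by apply: grM; apply: hcP.
rewrite exchange_big /= -{1}[x]hc_sum mulr_suml; apply: eq_bigr => e _.
by rewrite -mulr_sumr -{1}(hc_sum y) (reindex_inj (addIr (- e))).
Qed.

(** Comparing components of degree [d] in [x * 1 = x] shows that the degree 0 part of 1 fixes every
    homogeneous [x]. Hence it fixes 1, so it equals 1. *)
Lemma gr1 : S 0 1.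
Proof.
suff -> : 1 = hc S 1 0 by apply: hcP.
have e0 d x : S d x -> x * hc S 1 0 = x.
  move=> Sx; have := hcM x 1 d; rewrite mulr1 (bigD1 d) //= big1 ?addr0.
    by rewrite (hc_homog Sx) eqxx subrr.
  by move=> e ne; rewrite (hc_homog Sx) (negPf ne) mul0r.
rewrite -[RHS]mul1r -[X in X * _](hc_sum 1) mulr_suml -[LHS](hc_sum 1).
by apply: eq_bigr => d _; rewrite (e0 d) //; apply: hcP.
Qed.

Lemma grX d x n : S d x -> S (d *+ n) (x ^+ n).
Proof.
by move=> Sx; elim: n => [|n IH]; [exact: gr1 | rewrite exprS mulrS; exact: grM].
Qed.

(** The action of the dual group of [D] on complex homomorphisms: the part of degree [d] is rescaled
    by [chi d]. *)
Definition twist (chi : D -> algC) (t : R -> algC) (x : R) : algC :=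
  \sum_d chi d * t (hc S x d).

Lemma twist_homog chi t d x : zhom t -> S d x -> twist chi t x = chi d * t x.
Proof.
move=> tD Sx; rewrite /twist (bigD1 d) //= big1 ?addr0 ?(hc_homog Sx) ?eqxx // => e ne.
by rewrite (hc_homog Sx) (negPf ne) zhom0 // mulr0.
Qed.

Lemma twist_rhom (chi : D -> algC) t :
  (forall d e, chi (d + e) = chi d * chi e) -> chi 0 = 1 -> rhom t ->
  rhom (twist chi t).
Proof.
move=> chiD chi0 [tD tM t1]; have twD : zhom (twist chi t).
  move=> x y; rewrite /twist -big_split; apply: eq_bigr => d _ /=.
  by rewrite hcD tD mulrDr.
split=> // [x y|]; last by rewrite (twist_homog chi tD gr1) chi0 t1 mulr1.
rewrite -{1}(hc_sum x) mulr_suml zhom_sum // [twist chi t x]/twist mulr_suml.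
apply: eq_bigr => d _; rewrite -{1}(hc_sum y) [twist chi t y]/twist !mulr_sumr.
rewrite zhom_sum //; apply: eq_bigr => e _.
rewrite (twist_homog chi tD (grM (hcP x d) (hcP y e))).
by rewrite chiD tM mulrACA.
Qed.

(** Expanding the squares gives a double sum over degrees; orthogonality of the characters leaves
    only its diagonal. *)
Lemma parseval (J : finType) (chi : J -> D -> algC) t x :
  (forall d e, \sum_j chi j d * (chi j e)^* = #|D|%:R *+ (d == e)) ->
  \sum_j `|twist (chi j) t x| ^+ 2 = #|D|%:R * \sum_d `|t (hc S x d)| ^+ 2.
Proof.
move=> orth.
pose a d := t (hc S x d).
transitivity (\sum_d \sum_e a d * (a e)^* * \sum_j chi j d * (chi j e)^*).
  transitivity (\sum_j \sum_d \sum_e a d * (a e)^* * (chi j d * (chi j e)^*)).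
    apply: eq_bigr => j _; rewrite normCK /twist rmorph_sum mulr_suml.
    apply: eq_bigr => d _; rewrite mulr_sumr; apply: eq_bigr => e _.
    by rewrite rmorphM mulrACA mulrC.
  rewrite exchange_big; apply: eq_bigr => d _; rewrite exchange_big.
  by apply: eq_bigr => e _; rewrite mulr_sumr.
rewrite mulr_sumr; apply: eq_bigr => d _; rewrite (bigD1 d) //= [X in _ + X]big1 ?addr0.
  by rewrite orth eqxx mulr1n normCK mulrC.
by move=> e ne; rewrite orth eq_sym (negPf ne) mulr0n mulr0.
Qed.

End Grading.

(** * Common refinement of two gradings; roots of unity *)

Section Norm.
Variables (R : comPzRingType) (I : finType) (t : I -> R -> algC).
Hypotheses (tH : forall i, rhom (t i)) (t_inj : forall i j, t i =1 t j -> i = j)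
  (t_all : forall s, rhom s -> exists i, t i =1 s).

Definition sqnorm (x : R) : algC := \sum_i `|t i x| ^+ 2.

Lemma sqnorm_ge0 x : 0 <= sqnorm x.
Proof. by apply: sumr_ge0 => i _; rewrite exprn_ge0. Qed.

Lemma sqnorm_ge1 x : is_order R -> reduced R -> x <> 0 -> 1 <= sqnorm x.
Proof.
move=> hord hred x0.
have [/existsP[i ti]|/existsPn small] := boolP [exists i, 1 <= `|t i x|].
  rewrite /sqnorm (bigD1 i) //=; apply: ler_wpDr; last exact: exprn_ege1.
  by apply: sumr_ge0 => j _; rewrite exprn_ge0.
case: x0; apply: small_eq0 => // s /t_all[i ti].
by rewrite -ti real_ltNge ?normr_real ?real1 ?small.
Qed.

(** Twisting by a character permutes the homomorphisms, so it does not change the square norm.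
    Summing over all characters, Parseval separates the components. *)
Lemma sqnorm_grading (D : finZmodType) (S : D -> R -> Prop) x :
  is_grading S -> sqnorm x = \sum_d sqnorm (hc S x d).
Proof.
move=> hS; have [J [chi [cJ chiD chi0 chiN orth]]] := dual_characters D.
have D0 : #|D|%:R != 0 :> algC by rewrite pnatr_eq0 -lt0n; apply/card_gt0P; exists 0.
have step j : \sum_i `|twist S (chi j) (t i) x| ^+ 2 = sqnorm x.
  have [p pE] : exists p : I -> I, forall i, t (p i) =1 twist S (chi j) (t i).
    apply: (ClassicalEpsilon.choice (fun i k => t k =1 twist S (chi j) (t i))) => i.
    by apply: t_all; apply: twist_rhom.
  (* Injectivity suffices, [I] being finite. A twist can be undone because [chi j d] is nonzero. *)
  have p_inj : injective p.
    move=> i i' pp; apply: t_inj => y.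
    rewrite -(hc_sum hS y) !zhom_sum; [|by case: (tH i')|by case: (tH i)].
    apply: eq_bigr => d _; have Sy := hcP hS y d.
    have chi_neq0 : chi j d != 0 by rewrite -normr_gt0 chiN.
    apply: (mulfI chi_neq0); have [tD _ _] := tH i; have [tD' _ _] := tH i'.
    by rewrite -(twist_homog hS (chi j) tD Sy) -(twist_homog hS (chi j) tD' Sy) -!pE pp.
  rewrite [RHS](reindex_inj p_inj); apply: eq_bigr => i _; congr (`| _ | ^+ 2).
  by rewrite pE.
apply: (mulfI D0); rewrite -{1}cJ mulr_natl -sumr_const.
rewrite (eq_bigr _ (fun j _ => esym (step j))).
rewrite exchange_big /= mulr_sumr.
under eq_bigr do rewrite (parseval S _ _ orth).
rewrite -!mulr_sumr exchange_big /=.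
by congr (_ * _); apply: eq_bigr.
Qed.

End Norm.

(** If this holds for all [x], the intersections of an [S d] with a [T e] span the ring, which is
    what a common refinement requires. *)
Definition bihomog_sum (R : comPzRingType) (D E : finZmodType)
    (S : D -> R -> Prop) (T : E -> R -> Prop) (x : R) : Prop :=
  exists y : D -> E -> R,
    (forall d e, S d (y d e) /\ T e (y d e)) /\ x = \sum_d \sum_e y d e.

Section Refinement.
Variables (R : comPzRingType) (D E : finZmodType).
Variables (S : D -> R -> Prop) (T : E -> R -> Prop).
Hypotheses (hord : is_order R) (hred : reduced R).
Hypotheses (hS : is_grading S) (hT : is_grading T).
Local Notation bih := (bihomog_sum S T).

Lemma bihomog_sum_sum (K : finType) (F : K -> R) :
  (forall k, bih (F k)) -> bih (\sum_k F k).
Proof.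
move=> bF; elim/big_ind: _ => // [|x y [u [uP ->]] [v [vP ->]]].
  exists (fun _ _ => 0); split=> [d e|]; first by split; apply: gr0.
  by rewrite big1 // => d _; rewrite big1.
exists (fun d e => u d e + v d e); split=> [d e|].
  by have [? ?] := uP d e; have [? ?] := vP d e; split; apply: grD.
by rewrite -big_split; apply: eq_bigr => d _; rewrite -big_split.
Qed.

Lemma bihomog_sum1 d e x : S d x -> T e x -> bih x.
Proof.
move=> Sx Tx; exists (fun d' e' => if (d' == d) && (e' == e) then x else 0); split.
  move=> d' e'; case: andP => [[/eqP -> /eqP ->]|_] //.
  by split; apply: gr0.
rewrite (bigD1 d) //= eqxx (bigD1 e) //= eqxx /= !big1 ?addr0 // => [d' nd|e' ne].
  by rewrite big1 // => e' _; rewrite (negPf nd).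
by rewrite (negPf ne).
Qed.

(* Splitting an element into at least two nonzero components of a grading lowers the
   square norm of each part by at least 1, so alternately splitting along [S] and [T]
   terminates. *)
Lemma common_refinement x : bih x.
Proof.
have [I [t [tH t_inj t_all]]] := finite_homs hord.
pose q := sqnorm t.
have q1 z : z <> 0 -> 1 <= q z by apply: sqnorm_ge1.
have q_split (F : finZmodType) (U : F -> R -> Prop) z :
    is_grading U -> (forall d, hc U z d <> z) -> forall d, q (hc U z d) + 1 <= q z.
  move=> hU split d; have [e ne e0] : exists2 e, e != d & hc U z e <> 0.
    apply: NNPP => no; apply: (split d); rewrite -{2}(hc_sum hU z) (bigD1 d) //=.
    rewrite big1 ?addr0 // => e ne; apply: NNPP => e0.
    by apply: no; exists e.
  rewrite /q (sqnorm_grading tH t_inj t_all z hU) (bigD1 d) //= lerD2l.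
  rewrite (bigD1 e) //=; apply: ler_wpDr; last exact: q1.
  by apply: sumr_ge0 => k _; apply: sqnorm_ge0.
(* Square norms are real numbers, so the descent is an induction on a natural number bounding
   them. *)
have [n] : exists n : nat, q x <= n%:R.
  by exists (Num.bound (q x)); rewrite ltW // archi_boundP // sqnorm_ge0.
elim: n x => [|n IH] x qx.
  have -> : x = 0.
    by apply: NNPP => /q1 /le_trans /(_ qx); rewrite mulr0n ler10.
  by apply: (@bihomog_sum1 0 0); apply: gr0.
have down z : q z + 1 <= q x -> bih z.
  by move=> qz; apply: IH; rewrite -(lerD2r 1) natr1 (le_trans qz).
have [[d dx]|noS] := excluded_middle_informative (exists d, hc S x d = x); last first.
  rewrite -(hc_sum hS x); apply: bihomog_sum_sum => d; apply: down.
  by apply: q_split => // e ex; apply: noS; exists e.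
have [[e ex]|noT] := excluded_middle_informative (exists e, hc T x e = x); last first.
  rewrite -(hc_sum hT x); apply: bihomog_sum_sum => e; apply: down.
  by apply: q_split => // e' ex; apply: noT; exists e'.
by apply: (@bihomog_sum1 d e); [rewrite -dx | rewrite -ex]; apply: hcP.
Qed.

End Refinement.

Lemma mulrn_card (D : finZmodType) (d : D) : d *+ #|D| = 0.
Proof. by rewrite -FinRing.zmodXgE -cardsT cyclic.expg_cardG ?inE. Qed.

Lemma exprn_orthogonal_sum (R : comPzRingType) (D : finType) (u : D -> R) n :
  (forall d e, d != e -> u d * u e = 0) -> (\sum_d u d) ^+ n.+1 = \sum_d u d ^+ n.+1.
Proof.
move=> orth; elim: n => [|n IH]; first by rewrite expr1; apply: eq_bigr.
rewrite exprS IH mulr_suml; apply: eq_bigr => d _.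
rewrite mulr_sumr (bigD1 d) //= big1 ?addr0 ?exprS // => e ne.
by rewrite exprS mulrA orth ?mul0r // eq_sym.
Qed.

(* By Parseval over the twists of a homomorphism [t], the components [u_d] of a root of
   unity [u] satisfy [sum_d |t u_d|^2 = 1]; so [|t (u_d u_e)| <= 1/2] for [d != e], whence
   [u_d u_e = 0] and suitable powers of the [u_d] are orthogonal idempotents with sum 1.
   *)
Lemma root_of_unity_homog (R : comPzRingType) (D : finZmodType) (S : D -> R -> Prop) u :
  is_order R -> reduced R -> is_grading S -> (0 : R) <> 1 ->
  (forall e, S 0 e -> e * e = e -> e = 0 \/ e = 1) ->
  root_of_unity u -> exists d, S d u.
Proof.
move=> hord hred hS R0 hconn [n [n0 un]].
have [J [chi [cJ chiD chi0 chiN orth]]] := dual_characters D.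
have D0 : #|D|%:R != 0 :> algC by rewrite pnatr_eq0 -lt0n; apply/card_gt0P; exists 0.
pose v := hc S u.
have normu t : rhom t -> `|t u| = 1.
  move=> ht; apply/eqP; rewrite -(@pexpr_eq1 _ _ n) // -normrX -rhomX // un.
  by case: ht => _ _ ->; rewrite normr1.
have sum1 t : rhom t -> \sum_d `|t (v d)| ^+ 2 = 1.
  move=> ht; apply: (mulfI D0); rewrite -(parseval S _ _ orth) mulr1 -cJ.
  rewrite (eq_bigr (fun=> 1)) ?sumr_const // => j _.
  by rewrite normu ?expr1n //; apply: twist_rhom.
have vorth d e : d != e -> v d * v e = 0.
  move=> de; apply: small_eq0 => // t ht; have [_ tM _] := ht.
  rewrite tM normrM; apply: le_lt_trans (_ : 1 / 2%:R < 1).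
    (* The bound 1/2 comes from the inequality between a product and the mean of the two squares,
       applied to two terms of [sum1]. *)
    have [le _] := real_leif_mean_square (normr_real (t (v d))) (normr_real (t (v e))).
    apply: le_trans le _; rewrite ler_pM2r ?invr_gt0 ?ltr0n // -(sum1 t ht).
    rewrite (bigD1 d) //= lerD2l (bigD1 e) 1?eq_sym //=.
    by apply: ler_wpDr => //; apply: sumr_ge0 => k _; rewrite exprn_ge0.
  by rewrite ltr_pdivrMr ?ltr0n // mul1r ltr1n.
(* The factor [n] makes [u ^+ N] equal to 1, and the factor [#|D|] puts every [v d ^+ N] in degree
   0. *)
pose N := (n * #|D|)%N.
have N0 : (0 < N)%N by rewrite muln_gt0 n0; apply/card_gt0P; exists 0.
have uE : u = \sum_d v d by rewrite hc_sum.
have v1 : \sum_d v d ^+ N = 1.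
  by rewrite -(prednK N0) -exprn_orthogonal_sum // prednK // -uE exprM un expr1n.
have vid d : v d ^+ N * v d ^+ N = v d ^+ N.
  rewrite -[RHS]mulr1 -v1 mulr_sumr [RHS](bigD1 d) //= big1 ?addr0 // => e ne.
  by rewrite -exprMn vorth 1?eq_sym // -(prednK N0) expr0n.
have v01 d : v d ^+ N = 0 \/ v d ^+ N = 1.
  apply: hconn => //; rewrite -(mulrn_card (d *+ n)) -mulrnA.
  by apply: grX => //; apply: hcP.
have [d vd] : exists d, v d ^+ N = 1.
  apply: NNPP => no; apply: R0; rewrite -v1 big1 // => d _.
  by case: (v01 d) => // vd; case: no; exists d.
exists d; suff -> : u = v d by apply: hcP.
rewrite uE (bigD1 d) //= big1 ?addr0 // => e ne.
by rewrite -[v e]mulr1 -vd -(prednK N0) exprS mulrA vorth ?mul0r.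
Qed.

(** * Pushforwards and starkness *)

Lemma inj_surj_bij (T U : Type) (f : T -> U) :
  injective f -> (forall y, exists x, f x = y) -> bijective f.
Proof.
move=> finj fsurj.
have [g fgK] := ClassicalEpsilon.choice (fun y x => f x = y) fsurj.
by exists g => // x; apply: finj; rewrite fgK.
Qed.

Lemma sum_fibers (V : nmodType) (D E : finType) (f : D -> E) (F : D -> V) :
  \sum_e \sum_(d | f d == e) F d = \sum_d F d.
Proof.
rewrite (exchange_big_dep xpredT) //=; apply: eq_bigr => d _.
by rewrite (big_pred1 (f d)) // => e; rewrite /= eq_sym.
Qed.

Lemma grading_fin (R : pzRingType) (D : finZmodType) (S : D -> R -> Prop) :
  (forall d, S d 0 /\ forall x y, S d x -> S d y -> S d (x - y)) ->
  (forall d e x y, S d x -> S e y -> S (d + e) (x * y)) ->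
  (forall x : R, exists c : D -> R, (forall d, S d (c d)) /\ x = \sum_d c d) ->
  (forall c : D -> R, (forall d, S d (c d)) -> \sum_d c d = 0 -> forall d, c d = 0) ->
  is_grading S.
Proof.
move=> SB SM Ssum Sind; split=> // [x|r y r_uniq Sy y0 d dr].
  by have [c [Sc xE]] := Ssum x; exists (index_enum D), c.
have := Sind (fun d => if d \in r then y d else 0); move/(_ _ _ d); rewrite dr; apply.
  by move=> e; case: ifP => // _; case: (SB e).
by rewrite -big_mkcond -big_uniq.
Qed.

Lemma pullback_grading (R R' : pzRingType) (E : zmodType) (T : E -> R' -> Prop)
    (a : R -> R') :
  zhom a -> (forall x y, a (x * y) = a x * a y) -> bijective a ->
  is_grading T -> is_grading (fun e x => T e (a x)).
Proof.
move=> aD aM [b aK bK] [TB TM Tsum Tind].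
have bD : zhom b by move=> x y; apply: (can_inj aK); rewrite aD !bK.
split=> [e|d e x y|x|r y r_uniq Ty y0 d dr].
- by have [T0 TB'] := TB e; split=> [|x y]; rewrite ?zhom0 ?zhomB //; apply: TB'.
- by rewrite aM; apply: TM.
- have [r [y [Ty xE]]] := Tsum (a x); exists r, (b \o y); split=> [d|].
    by rewrite /= bK.
  by rewrite -[x]aK xE zhom_sum.
apply: (can_inj aK); rewrite [RHS]zhom0 //; apply: (Tind r (a \o y)) => //.
by rewrite -[RHS](zhom0 aD) -y0 zhom_sum.
Qed.

Section Pushforward.
Variables (R : comPzRingType) (D E : finZmodType) (S : D -> R -> Prop) (f : D -> E).
Hypotheses (hS : is_grading S) (fD : zhom f).

Lemma pushforwardP e x :
  pushforward S f e x <-> forall d, f d != e -> hc S x d = 0.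
Proof.
split=> [[y [Sy ->]] d fd|x0].
  rewrite (zhom_sum (hcD hS d)) big1 // => a /eqP fa.
  by rewrite (hc_homog hS (Sy a)); case: eqP => // da; rewrite da fa eqxx in fd.
exists (hc S x); split; first exact: hcP.
by rewrite -{1}(hc_sum hS x) (bigID (fun d => f d == e)) /= [X in _ + X]big1 ?addr0.
Qed.

Lemma pushforward_homog d x : S d x -> pushforward S f (f d) x.
Proof.
move=> Sx; apply/pushforwardP => e fe; rewrite (hc_homog hS Sx).
by case: eqP => // ed; rewrite ed eqxx in fe.
Qed.

Lemma pushforward_grading : is_grading (pushforward S f).
Proof.
apply: grading_fin => [e|d e x y|x|c Sc c0 e].
- split=> [|x y /pushforwardP x0 /pushforwardP y0]; apply/pushforwardP => d fd.
    exact: (zhom0 (hcD hS d)).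
  by rewrite (zhomB (hcD hS d)) x0 ?y0 ?subr0.
- move=> /pushforwardP x0 /pushforwardP y0; apply/pushforwardP => a fa.
  rewrite hcM // big1 // => b _; have [fb|/x0 ->] := eqVneq (f b) d; last by rewrite mul0r.
  rewrite y0 ?mulr0 // zhomB // fb; apply: contra fa => /eqP <-.
  by rewrite addrC subrK.
- exists (fun e => \sum_(d | f d == e) hc S x d); split=> [e|].
    by exists (hc S x); split=> //; apply: hcP.
  by rewrite sum_fibers hc_sum.
rewrite -(hc_sum hS (c e)) big1 // => d _.
have [<-|] := eqVneq (f d) e; last by move/pushforwardP: (Sc e); apply.
have := congr1 (fun x => hc S x d) c0; rewrite (zhom_sum (hcD hS d)).
rewrite (zhom0 (hcD hS d)) (bigD1 (f d)) //= big1 ?addr0 // => e' ne.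
by move/pushforwardP: (Sc e'); apply; rewrite eq_sym.
Qed.

End Pushforward.

(** Here [pi d] is the projection to the component indexed by [d]. An injective [k] on a finite set
    is a permutation, so maps that are bijective from component [d] to component [k d] glue to a
    bijection. *)
Lemma graded_bij (V : zmodType) (K : finType) (pi : K -> V -> V) (f : V -> V)
    (k : K -> K) :
  (forall d, zhom (pi d)) -> (forall x, \sum_d pi d x = x) ->
  zhom f -> injective k -> (forall d x, pi (k d) (f x) = f (pi d x)) ->
  (forall d x, f (pi d x) = 0 -> pi d x = 0) ->
  (forall d y, exists x, f x = pi (k d) y) -> bijective f.
Proof.
move=> piD pi_sum fD k_inj f_pi finj fsurj; apply: inj_surj_bij => [x y fxy|y].
  apply/eqP; rewrite -subr_eq0 -(pi_sum (x - y)) big1 // => d _.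
  by apply: finj; rewrite -f_pi zhomB // fxy subrr zhom0.
have [x xP] := ClassicalEpsilon.choice _ (fun d => fsurj d y).
exists (\sum_d x d); rewrite zhom_sum // -[RHS]pi_sum [RHS](reindex_inj k_inj).
by apply: eq_bigr.
Qed.

(** * Graded rings with a multiplicative choice of units are group rings *)

Section Subring.
Variables (A : comPzRingType) (P : A -> Prop).
Hypotheses (P1 : P 1) (PB : forall x y, P x -> P y -> P (x - y))
  (PM : forall x y, P x -> P y -> P (x * y)).

Let S : {pred A} := fun x => decide (P x).

Let S_closed : subring_closed S.
Proof.
split=> [|x y|x y]; first exact/decideP.
- by move=> /decideP ? /decideP ?; apply/decideP/PB.
- by move=> /decideP ? /decideP ?; apply/decideP/PM.
Qed.

Record subring_type := SubringType { subring_val : A; _ : subring_val \in S }.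
HB.instance Definition _ := [isSub for subring_val].
HB.instance Definition _ := [Choice of subring_type by <:].
HB.instance Definition _ := GRing.SubChoice_isSubPzRing.Build A S subring_type S_closed.

(** This turns the degree 0 part of a grading into a ring of its own, to serve as the coefficients
    of a group ring. *)
Lemma subring_exists : exists (B : pzRingType) (v : B -> A) (w : A -> B),
  [/\ zhom v, forall x y, v (x * y) = v x * v y, v 1 = 1, injective v &
      (forall b, P (v b)) /\ forall x, P x -> v (w x) = x].
Proof.
exists subring_type, val, (fun x => insubd 0 x); split=> //; first exact: val_inj.
split=> [b|x Px]; first exact/decideP/(valP b).
by rewrite insubdK //; apply/decideP.
Qed.

End Subring.

Section CrossedProduct.
Variables (A : comPzRingType) (D : finZmodType) (T : D -> A -> Prop) (K : {group D}).
Variable u : D -> A.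
Hypotheses (hT : is_grading T) (TK : forall d x, d \notin K -> T d x -> x = 0).
Hypotheses (uD : forall d e, u (d + e) = u d * u e) (u0 : u 0 = 1)
  (uT : forall d, d \in K -> T d (u d)).

(** Multiplying the component of degree [d] by the inverse [u (- d)] of [u d] brings it to degree 0.
    Since [u] is multiplicative, these quotients multiply like the coefficients in a group ring of
    [K] over the degree 0 part. *)
Lemma unit_graded_group_ring :
  exists (B : pzRingType) (phi : A -> {ffun subg_of K -> B}), iso_group_ring phi.
Proof.
have uN d : u d * u (- d) = 1 by rewrite -uD subrr.
have hc0 d x : d \notin K -> hc T x d = 0.
  by move=> dK; apply: (TK dK); apply: hcP.
have sumK (F : D -> A) : (forall d, d \notin K -> F d = 0) ->
    \sum_(a : subg_of K) F (sgval a) = \sum_d F d.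
  move=> F0; rewrite (bigID (mem K)) /= [X in _ = _ + X]big1 // addr0.
  rewrite (reindex (fun a : subg_of K => sgval a : D)) /=; first by apply: eq_bigl => a; rewrite subgP.
  by exists (subg K); [move=> x _; exact: sgvalK | move=> x xK; exact: subgK].
have T0M x y : T 0 x -> T 0 y -> T 0 (x * y).
  by move=> Tx Ty; have := grM hT Tx Ty; rewrite addr0.
have [B [v [w [vD vM v1 v_inj [vT wT]]]]] :=
  subring_exists (gr1 hT) (fun x y => @grB _ _ _ hT 0 x y) T0M.
pose p x d := hc T x d * u (- d).
have pT x d : d \in K -> T 0 (p x d).
  move=> dK; have := grM hT (hcP hT x d) (uT (groupVr dK)).
  by rewrite FinRing.zmodVgE subrr.
exists B, (fun x => [ffun a : subg_of K => w (p x (sgval a))]).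
have vphi x (a : subg_of K) : v (w (p x (sgval a))) = p x (sgval a).
  by rewrite wT //; apply/pT/subgP.
split=> [x y|x y||].
- apply/ffunP => a; rewrite !ffunE; apply: v_inj; rewrite vD !vphi.
  by rewrite /p (hcD hT) mulrDl.
- apply/ffunP => a; rewrite !ffunE; apply: v_inj; rewrite vphi zhom_sum //.
  rewrite /p hcM // mulr_suml -sumK => [|d dK]; last by rewrite hc0 ?mul0r.
  apply: eq_bigr => b _; rewrite zhom_sum // (big_pred1 (b^-1 * a)%g) => [|c] /=.
    rewrite !ffunE vM !vphi /p mulrACA -uD.
    have -> : sgval (b^-1 * a)%g = sgval a - sgval b by rewrite addrC.
    by rewrite opprB addKr.
  by apply/eqP/eqP => [<-|->]; rewrite ?mulKg ?mulKVg.
- apply/ffunP => a; rewrite !ffunE; apply: v_inj; rewrite vphi /p (hc_homog hT (gr1 hT)).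
  rewrite -[X in _ == X]/(sgval (1%g : subg_of K)) (inj_eq val_inj).
  case: eqP => [->|_]; last by rewrite mul0r zhom0.
  by rewrite mul1r v1 oppr0.
apply: inj_surj_bij => [x y /ffunP xy|b].
  rewrite -(hc_sum hT x) -(hc_sum hT y); apply: eq_bigr => d _.
  have [dK|dK] := boolP (d \in K); last by rewrite !hc0.
  have := xy (subg K d); rewrite !ffunE => /(congr1 v); rewrite !vphi subgK // /p.
  by move=> /(congr1 (fun z => z * u d)); rewrite -!mulrA [u (- d) * _]mulrC uN !mulr1.
pose c d := if d \in K then v (b (subg K d)) * u d else 0.
have Tc d : T d (c d).
  rewrite /c; case: ifP => dK; last exact: gr0.
  by have := grM hT (vT (b (subg K d))) (uT dK); rewrite add0r.
exists (\sum_d c d); apply/ffunP => a; rewrite ffunE; apply: v_inj; rewrite vphi /p.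
rewrite (hc_uniq hT Tc (erefl _)) /c subgP sgvalK -mulrA uN mulr1 //.
Qed.

End CrossedProduct.

(** By the pigeonhole principle two iterates of [r] coincide, so the iterates are eventually
    periodic. *)
Lemma idempotent_iterate (T : finType) (r : T -> T) :
  exists2 n, (0 < n)%N & forall x, iter n r (iter n r x) = iter n r x.
Proof.
pose F (i : 'I_(#|{ffun T -> T}|.+1)) : {ffun T -> T} := [ffun x => iter i r x].
have [i [j ij Fij]] : exists i : 'I__, exists2 j : 'I__, (i < j)%N & F i = F j.
  have : ~~ injectiveb F.
    by apply/negP => /injectiveP /leq_card; rewrite card_ord ltnn.
  move/injectivePn => [i [j ne Fij]]; move: ne; rewrite neq_ltn => /orP[lt|lt].
    by exists i, j.
  by exists j, i.
pose p := (nat_of_ord j - nat_of_ord i)%N.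
have per m x : (i <= m)%N -> iter (m + p) r x = iter m r x.
  move=> im; have := congr1 (fun G : {ffun T -> T} => G x) Fij; rewrite !ffunE => e.
  have -> : (m + p = m - i + j)%N by rewrite /p -{1}(subnK im) -addnA subnKC // ltnW.
  by rewrite iterD -e -iterD subnK.
have perk k m x : (i <= m)%N -> iter (m + k * p) r x = iter m r x.
  move=> im; elim: k => [|k IH]; first by rewrite addn0.
  by rewrite mulSn addnCA addnC per ?IH // (leq_trans im) ?leq_addr.
have p0 : (0 < p)%N by rewrite subn_gt0.
(* A positive multiple of the period [p] that is at least [i], where periodicity begins. *)
exists (i.+1 * p)%N; first by rewrite muln_gt0.
by move=> x; rewrite -iterD perk // (leq_trans (leqnSn i)) // leq_pmulr.
Qed.

(* If [y <> 0], the idempotent power [E] of [r] gives a nontrivial retract [E D] of [D],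
   and the units [h (r^(N-1) d)] of degree [d], for [d] in [E D], exhibit [A] as a group
   ring over [E D]. *)
Lemma stark_fixed_point (A : comPzRingType) (D : finZmodType) (S : D -> A -> Prop)
    (h : D -> A) (r : D -> D) y :
  stark A -> is_grading S -> (forall a b, h (a + b) = h a * h b) -> h 0 = 1 ->
  zhom r -> (forall d, S (r d) (h d)) -> r y = y -> y = 0.
Proof.
move=> hstark hS hD h0 rD Sh ry; apply/eqP; apply: contraT => y0; case: hstark.
have [[//|n] _ EE] := idempotent_iterate r.
pose E := iter n.+1 r; have iterrD k : zhom (iter k r).
  by elim: k => [|k IH] a b //; rewrite !iterS IH rD.
have hT := pushforward_grading hS (iterrD n.+1).
have Kg : group_set [set E d | d in [set: D]].
  apply/group_setP; split; first by apply/imsetP; exists 0; rewrite ?inE // /E zhom0.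
  move=> _ _ /imsetP[a _ ->] /imsetP[b _ ->]; apply/imsetP.
  by exists (a + b); rewrite ?inE // /E iterrD.
pose K := Group Kg; pose u d := h (iter n r d).
have KE d : d \in K -> E d = d by case/imsetP => a _ ->; exact: EE.
have [B [phi iso]] : exists (B : pzRingType) (phi : A -> {ffun subg_of K -> B}), iso_group_ring phi.
  apply: (@unit_graded_group_ring _ _ _ K u hT) => [d x dK|d e||d dK].
  - move/(pushforwardP E hS) => x0; rewrite -(hc_sum hS x) big1 // => a _; apply: x0.
    by apply: contraNneq dK => <-; apply: imset_f.
  - by rewrite /u iterrD hD.
  - by rewrite /u zhom0.
  - have Su : S (E d) (u d) by apply: Sh.
    by have := pushforward_homog E hS Su; rewrite !KE.
exists B, (subg_of K), phi; split=> //.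
have Ky : y \in K.
  apply/imsetP; exists y; rewrite ?inE // /E.
  by elim: n.+1 => [|k IH] //; rewrite iterS -IH.
apply/card_gt1P; exists (subg K y), 1%g; split=> //.
by apply: contraNneq y0 => /(congr1 sgval); rewrite subgK // => ->.
Qed.

(** * The group ring *)

Section GroupRing.
Variables (A : comPzRingType) (G : finZmodType).

(* An alias of [{ffun G -> A}], whose default ring structure is the pointwise one. *)
Definition gring : Type := {ffun G -> A}.
HB.instance Definition _ := GRing.Zmodule.copy gring {ffun G -> A}.
Implicit Types u v w : gring.

Definition grmul u v : gring := gmul (@GRing.add G) u v.

Lemma grmulE u v h : grmul u v h = \sum_a u a * v (h - a).
Proof.
rewrite ffunE; apply: eq_bigr => a _; rewrite (big_pred1 (h - a)) // => b /=.
by rewrite [RHS]eq_sym subr_eq [LHS]eq_sym addrC.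
Qed.

Lemma grmulA : associative grmul.
Proof.
move=> u v w; apply/ffunP => h; rewrite !grmulE.
under [RHS]eq_bigr do rewrite grmulE mulr_suml.
rewrite exchange_big /=; apply: eq_bigr => a _; rewrite grmulE mulr_sumr.
rewrite (reindex_inj (addIr (- a))); apply: eq_bigr => b _ /=.
by rewrite mulrA; congr (_ * w _); rewrite opprB addrA subrK.
Qed.

Lemma grmulC : commutative grmul.
Proof.
move=> u v; apply/ffunP => h; rewrite !grmulE (reindex_inj (subrI h)).
by apply: eq_bigr => a _; rewrite subKr mulrC.
Qed.

Lemma grmul1 : left_id (gone (0 : G) A : gring) grmul.
Proof.
move=> u; apply/ffunP => h; rewrite grmulE (bigD1 0) //= big1 => [|a /negPf a0].
  by rewrite ffunE eqxx mul1r subr0 addr0.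
by rewrite ffunE a0 mul0r.
Qed.

Lemma grmulDl : left_distributive grmul +%R.
Proof.
move=> u v w; apply/ffunP => h; rewrite [RHS]ffunE !grmulE -big_split.
by apply: eq_bigr => a _; rewrite ffunE mulrDl.
Qed.

HB.instance Definition _ :=
  GRing.Zmodule_isComPzRing.Build gring grmulA grmulC grmul1 grmulDl.

Definition gel (x : A) (g : G) : gring := gelt x g.

Lemma gelE x g h : gel x g h = if h == g then x else 0.
Proof. by rewrite ffunE. Qed.

Lemma gelD g : zhom (gel^~ g).
Proof. by move=> x y; apply/ffunP => h; rewrite !ffunE; case: eqP; rewrite ?addr0. Qed.

Lemma gel1 : gel 1 0 = 1.
Proof. by []. Qed.

Lemma gelM x y g h : gel x g * gel y h = gel (x * y) (g + h).
Proof.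
apply/ffunP => k; rewrite [LHS]grmulE (bigD1 g) //= big1 ?addr0 => [|a /negPf ag].
  by rewrite !gelE eqxx subr_eq [h + g]addrC; case: eqP; rewrite ?mulr0.
by rewrite gelE ag mul0r.
Qed.

Lemma gel_inj g : injective (gel^~ g).
Proof. by move=> x y /ffunP /(_ g); rewrite !gelE eqxx. Qed.

Lemma gelX x g n : gel x g ^+ n = gel (x ^+ n) (g *+ n).
Proof. by elim: n => [|n IH] //; rewrite !exprS IH gelM mulrS. Qed.

Lemma gel_eq x y g h : gel x g = gel y h -> x <> 0 -> x = y /\ g = h.
Proof.
move=> /ffunP /(_ g); rewrite !gelE eqxx; case: eqP => [-> -> //|_ -> x0].
by case: x0.
Qed.

Lemma gel_sum u : \sum_g gel (u g) g = u.
Proof.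
apply/ffunP => h; rewrite sum_ffunE (bigD1 h) //= big1 ?addr0 => [|g gh].
  by rewrite gelE eqxx.
by rewrite gelE eq_sym (negPf gh).
Qed.

(** The augmentation of the group ring, sending each group element to 1. *)
Definition augm u : A := \sum_g u g.

Lemma augmD : zhom augm.
Proof. by move=> u v; rewrite -big_split; apply: eq_bigr => g _; rewrite ffunE. Qed.

Lemma augm_gel x g : augm (gel x g) = x.
Proof.
rewrite /augm (bigD1 g) //= big1 ?addr0 => [|h /negPf hg]; first by rewrite gelE eqxx.
by rewrite gelE hg.
Qed.

Lemma augmM u v : augm (u * v) = augm u * augm v.
Proof.
rewrite -(gel_sum u) -(gel_sum v) mulr_suml !(zhom_sum augmD) mulr_suml.
apply: eq_bigr => g _; rewrite !mulr_sumr (zhom_sum augmD).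
by apply: eq_bigr => h _; rewrite gelM !augm_gel.
Qed.

Definition gr_grading g u : Prop := forall h, h != g -> u h = 0.

Lemma gr_gradingP g u : gr_grading g u <-> u = gel (u g) g.
Proof.
split=> [ug|-> h /negPf hg]; last by rewrite gelE hg.
by apply/ffunP => h; rewrite gelE; case: eqVneq => [->|/ug].
Qed.

Lemma gr_grading_gel x g : gr_grading g (gel x g).
Proof. by apply/gr_gradingP; rewrite gelE eqxx. Qed.

Lemma gr_grading_is_grading : is_grading gr_grading.
Proof.
apply: grading_fin => [g|g h u v /gr_gradingP -> /gr_gradingP ->|u|c Sc c0 g].
- split=> [h _|u v ug vg h hg]; first by rewrite ffunE.
  by rewrite !ffunE ug ?vg ?subr0.
- by rewrite gelM; apply: gr_grading_gel.
- by exists (fun g => gel (u g) g); rewrite gel_sum; split=> // g; apply: gr_grading_gel.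
apply/ffunP => h; rewrite [RHS]ffunE; have [->|/Sc //] := eqVneq h g.
have := congr1 (fun u : gring => u g) c0; rewrite sum_ffunE (bigD1 g) //= big1.
  by rewrite addr0 ffunE.
by move=> k kg; apply: Sc; rewrite eq_sym.
Qed.

Lemma hc_gr u g : hc gr_grading u g = gel (u g) g.
Proof.
apply: (hc_uniq gr_grading_is_grading (c := fun g => gel (u g) g)).
  by move=> h; apply: gr_grading_gel.
by rewrite gel_sum.
Qed.

Lemma gring_is_order : is_order A -> is_order gring.
Proof.
move=> [n [f [fD [f' fK f'K]]]].
pose F u : 'rV[int]_(#|G| * n) := mxvec (\matrix_(i < #|G|) f (u (enum_val i))).
pose F' (M : 'rV[int]_(#|G| * n)) : gring :=
  [ffun g => f' (row (enum_rank g) (vec_mx M))].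
exists (#|G| * n)%N, F; split; last exists F'.
- move=> u v; rewrite /F -linearD; congr mxvec; apply/row_matrixP => i.
  by rewrite linearD /= !rowK -fD; congr f; rewrite ffunE.
- by move=> u; apply/ffunP => g; rewrite ffunE mxvecK rowK enum_rankK fK.
move=> M; rewrite /F -[RHS]vec_mxK; congr mxvec; apply/row_matrixP => i.
by rewrite rowK ffunE f'K enum_valK.
Qed.

(** A homomorphism [t] of [A], composed with the augmentation, gives a homomorphism of the group
    ring whose twists all kill a nilpotent [u]. Parseval then forces [t (u g) = 0] for every [g],
    and an element of [A] killed by all [t] is zero. *)
Lemma gring_reduced : is_order A -> reduced A -> reduced gring.
Proof.
move=> hord hred u n un; apply/ffunP => g; rewrite [RHS]ffunE.
apply: small_eq0 => // t [tD tM t1].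
suff -> : t (u g) = 0 by rewrite normr0 ltr01.
have [J [chi [_ chiD chi0 _ orth]]] := dual_characters G.
have ht : rhom (t \o augm).
  split=> [v w|v w|] /=; rewrite ?augmD ?tD ?augmM ?tM //.
  by rewrite -gel1 augm_gel.
have G0 : #|G|%:R != 0 :> algC by rewrite pnatr_eq0 -lt0n; apply/card_gt0P; exists 0.
have : \sum_h `|(t \o augm) (hc gr_grading u h)| ^+ 2 = 0.
  apply: (mulfI G0); rewrite -(parseval _ _ _ orth) mulr0 big1 // => j _.
  have hj := twist_rhom gr_grading_is_grading (chiD j) (chi0 j) ht.
  have /eqP : twist gr_grading (chi j) (t \o augm) u ^+ n = 0.
    by rewrite -rhomX // un; case: hj => /zhom0.
  by rewrite expf_eq0 => /andP[_ /eqP ->]; rewrite normr0 expr0n.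
move/eqP; rewrite psumr_eq0 => [/allP /(_ g)|h _]; last by rewrite exprn_ge0.
rewrite mem_index_enum /= hc_gr augm_gel => /(_ isT).
by rewrite expf_eq0 normr_eq0 => /andP[_ /eqP].
Qed.

End GroupRing.

(** * The universal grading *)

Lemma root_of_unityM (A : comPzRingType) (x y : A) :
  root_of_unity x -> root_of_unity y -> root_of_unity (x * y).
Proof.
move=> [m [m0 xm]] [n [n0 yn]]; exists (m * n)%N; rewrite muln_gt0 m0 n0; split=> //.
by rewrite exprMn exprM xm expr1n mul1r mulnC exprM yn expr1n.
Qed.

Lemma root_of_unity_morph (A B : comPzRingType) (f : A -> B) x :
  (forall x y, f (x * y) = f x * f y) -> f 1 = 1 ->
  root_of_unity x -> root_of_unity (f x).
Proof.
move=> fM f1 [n [n0 xn]]; exists n; split=> //.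
by rewrite -[RHS]f1 -xn; elim: {n0 xn}n => [|n IH]; rewrite ?expr0 // !exprS fM IH.
Qed.

Lemma root_of_unity_gel (A : comPzRingType) (G : finZmodType) (z : A) (g : G) :
  root_of_unity z -> root_of_unity (gel z g).
Proof.
move=> [n [n0 zn]]; exists (n * #|G|)%N; split.
  by rewrite muln_gt0 n0; apply/card_gt0P; exists 0.
by rewrite gelX exprM zn expr1n mulrnA mulrn_card gel1.
Qed.

Lemma hom_mu0 (A : comPzRingType) (G : finZmodType) (s : G -> A) : hom_mu s -> s 0 = 1.
Proof.
move=> [su sD]; have [[|n] [// _ s0]] := su 0.
have s00 : s 0 * s 0 = s 0 by rewrite -sD addr0.
rewrite -s0; elim: n {s0} => [|n IH] //.
by rewrite exprS -IH s00.
Qed.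

Lemma hom_muN (A : comPzRingType) (G : finZmodType) (s : G -> A) g :
  hom_mu s -> s g * s (- g) = 1.
Proof. by move=> hs; have [_ sD] := hs; rewrite -sD subrr hom_mu0. Qed.

Lemma zaut_inj (U : finZmodType) (f : U -> U) : zhom f -> injective f -> zaut f.
Proof. by move=> fD /injF_bij fB; split. Qed.

Lemma zhom_inj0 (U V : zmodType) (f : U -> V) :
  zhom f -> (forall x, f x = 0 -> x = 0) -> injective f.
Proof.
move=> fD f0 x y fxy; apply/eqP; rewrite -subr_eq0; apply/eqP/f0.
by rewrite zhomB // fxy subrr.
Qed.

Lemma ring_aut_inv (A : pzRingType) (a : A -> A) : ring_aut a ->
  exists b, [/\ ring_aut b, cancel a b & cancel b a].
Proof.
move=> [aD aM a1 [b aK bK]]; exists b; split=> //; split=> [x y|x y||].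
- by apply: (can_inj aK); rewrite aD !bK.
- by apply: (can_inj aK); rewrite aM !bK.
- by apply: (can_inj aK); rewrite bK a1.
by exists a.
Qed.

(** * The degree map and the automorphisms of [A] *)

Section Main.
Variables (A : comPzRingType) (Gam : finZmodType) (Agr : Gam -> A -> Prop).
Hypotheses (hord : is_order A) (hred : reduced A) (hconn : connected A) (hstark : stark A)
  (huniv : universal_grading Agr).

Let hS : is_grading Agr := proj1 huniv.

Lemma universal_hom (E : finZmodType) (T : E -> A -> Prop) : is_grading T ->
  exists2 t : Gam -> E, zhom t & forall c x, Agr c x -> T (t c) x.
Proof.
move=> hT; have [f [[fD fT] _]] := proj2 huniv E T hT.
by exists f => // c x cx; apply/fT/pushforward_homog.
Qed.

(** Containment of each [Agr c] in [T (t c)] already makes [T] the pushforward along [t]: regrouping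
    the components of [x] along [t] gives its components for [T]. The uniqueness clause of
    universality then applies. *)
Lemma universal_uniq (E : finZmodType) (T : E -> A -> Prop) (t t' : Gam -> E) :
  is_grading T -> zhom t -> zhom t' ->
  (forall c x, Agr c x -> T (t c) x) -> (forall c x, Agr c x -> T (t' c) x) ->
  t =1 t'.
Proof.
move=> hT tD tD' tT tT'; have [f [_ f_uniq]] := proj2 huniv E T hT.
suff push s : (forall c x, Agr c x -> T (s c) x) ->
    forall e x, T e x <-> pushforward Agr s e x.
  by move=> c; rewrite (f_uniq t tD (push t tT)) (f_uniq t' tD' (push t' tT')).
move=> sT e x; split=> [Tx|[y [Ay ->]]]; last first.
  by apply: (gr_sum hT) => c /eqP <-; apply: sT.
exists (hc Agr x); split; first exact: hcP.
transitivity (hc T x e); first by rewrite (hc_homog hT Tx) eqxx.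
apply: (hc_uniq hT (c := fun e => \sum_(c | s c == e) hc Agr x c)) => [d|].
  by apply: (gr_sum hT) => c /eqP <-; apply: sT; apply: hcP hS _ _.
by rewrite sum_fibers hc_sum.
Qed.

(** This says that the degrees of nonzero components generate [Gam]. Both maps induce the
    pushforward grading along [t], so universality identifies them. *)
Lemma universal_generate (E : finZmodType) (t t' : Gam -> E) :
  zhom t -> zhom t' -> (forall c x, Agr c x -> x <> 0 -> t c = t' c) -> t =1 t'.
Proof.
move=> tD tD' tt'; have hT := pushforward_grading hS tD.
apply: (universal_uniq hT) => // c x cx; first exact: pushforward_homog.
have [->|/eqP x0] := eqVneq x 0; first exact: gr0.
by rewrite -(tt' c x) //; apply: pushforward_homog.
Qed.

Lemma A1_neq0 : (1 : A) <> 0. Proof. by case: hconn => /nesym. Qed.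

Lemma root_of_unity_reg (z x : A) : root_of_unity z -> x * z = 0 -> x = 0.
Proof.
move=> [[|n] [// _ zn]] xz.
by rewrite -[x]mulr1 -zn exprS mulrA xz mul0r.
Qed.

Lemma root_of_unity_neq0 (z : A) : root_of_unity z -> z <> 0.
Proof.
move=> hz z0; apply: A1_neq0; apply: (root_of_unity_reg hz).
by rewrite z0 mulr0.
Qed.

Lemma homog_uniq c d x : Agr c x -> Agr d x -> x <> 0 -> c = d.
Proof.
move=> cx dx x0; have := hc_homog hS cx c; rewrite eqxx (hc_homog hS dx).
by case: eqP => // _ /esym.
Qed.

Lemma degP z : root_of_unity z -> Agr (deg Agr z) z.
Proof.
move=> hz; apply: (epsilon_spec (inhabits 0) (fun c => Agr c z)).
by apply: root_of_unity_homog => //; [case: hconn | case: hconn => _ h e _; apply: h].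
Qed.

Lemma deg_uniq c z : root_of_unity z -> Agr c z -> deg Agr z = c.
Proof. by move=> hz cz; apply: homog_uniq (degP hz) cz _; apply: root_of_unity_neq0. Qed.

Lemma degM z w : root_of_unity z -> root_of_unity w ->
  deg Agr (z * w) = deg Agr z + deg Agr w.
Proof.
move=> hz hw; apply: deg_uniq; first exact: root_of_unityM.
by apply: grM => //; apply: degP.
Qed.

Lemma deg_hom (E : finZmodType) (h : E -> A) : hom_mu h -> zhom (fun x => deg Agr (h x)).
Proof. by move=> [hu hD] x y; rewrite hD degM. Qed.

(** All later uses of starkness pass through this fixed point statement. *)
Lemma deg_hom_fixed (h : Gam -> A) c : hom_mu h -> deg Agr (h c) = c -> c = 0.
Proof.
move=> hh; have [hu hD] := hh.
apply: (stark_fixed_point hstark hS hD (hom_mu0 hh) (deg_hom hh)) => d.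
exact: degP.
Qed.

(** Universality, applied to the gradings pulled back along [a] and its inverse, yields mutually
    inverse maps of degrees, so the choice in [alphaG] has a witness [t]. Its defining property
    concerns nonzero components only, but uniqueness identifies the chosen map with [t], which gives
    all degrees. *)
Lemma alphaG_spec a : ring_aut a ->
  zaut (alphaG Agr a) /\ forall c x, Agr c x <-> Agr (alphaG Agr a c) (a x).
Proof.
move=> ha; have [b [hb aK bK]] := ring_aut_inv ha.
have transport (f : A -> A) : ring_aut f ->
    exists2 t : Gam -> Gam, zhom t & forall c x, Agr c x -> Agr (t c) (f x).
  by case=> fD fM _ fB; apply: (universal_hom (pullback_grading fD fM fB hS)).
have [t tD tA] := transport a ha; have [t' tD' tA'] := transport b hb.
have t'K : cancel t t'.
  apply: (universal_uniq hS) => // [c d|c x cx]; first by rewrite tD tD'.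
  by rewrite -[x]aK; apply: tA'; apply: tA.
have tE c x : Agr c x <-> Agr (t c) (a x).
  by split=> [/tA //|/tA']; rewrite t'K aK.
have [fB fP] : zaut (alphaG Agr a) /\
    forall c, (exists x, Agr c x /\ x <> 0) ->
      forall y, Agr (alphaG Agr a c) y <-> exists x, Agr c x /\ y = a x.
  apply: (epsilon_spec (inhabits id) (fun f : Gam -> Gam => zaut f /\
    forall c, (exists x, Agr c x /\ x <> 0) ->
      forall y, Agr (f c) y <-> exists x, Agr c x /\ y = a x)).
  exists t; split=> [|c _ y]; first exact: zaut_inj tD (can_inj t'K).
  split=> [cy|[x [cx ->]]]; last exact: tA.
  by exists (b y); rewrite bK; split=> //; apply: (tE _ _).2; rewrite bK.
suff tt : alphaG Agr a =1 t by split=> // c x; rewrite tt.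
have [aD aM _ aB] := ha.
apply: (universal_uniq (pullback_grading aD aM aB hS)) => // [|c x cx]; first by case: fB.
have [->|/eqP x0] := eqVneq x 0; first by rewrite zhom0 //; apply: gr0.
by apply/fP; exists x.
Qed.

Lemma alphaG_deg a z : ring_aut a -> root_of_unity z ->
  deg Agr (a z) = alphaG Agr a (deg Agr z).
Proof.
move=> ha hz; have [_ aM a1 _] := ha; apply: deg_uniq.
  exact: root_of_unity_morph.
by apply: ((alphaG_spec ha).2 _ _).1; apply: degP.
Qed.

Lemma hom_mu_aut (E F : finZmodType) (a : A -> A) (h : E -> A) (t : F -> E) :
  (forall x y, a (x * y) = a x * a y) -> a 1 = 1 -> hom_mu h -> zhom t ->
  hom_mu (a \o h \o t).
Proof.
move=> aM a1 [hu hD] tD; split=> [c|c d] /=; last by rewrite tD hD aM.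
exact: root_of_unity_morph.
Qed.

Lemma add_autE a h c x : zhom a -> Agr c x -> add_aut Agr a h x = a x * h c.
Proof.
move=> aD cx; rewrite /add_aut (bigD1 c) //= big1 ?addr0 => [|d /negPf dc].
  by rewrite (hc_homog hS cx) eqxx.
by rewrite (hc_homog hS cx) dc zhom0 // mul0r.
Qed.

(** The map sends degree [c] to [k c], the sum of [alphaG Agr a c] and the degree of [h c]. If
    [k c = 0], then with [b] inverse to [a] the root of unity [b (h (- c))] has degree [c], so
    [c = 0] by starkness. Thus [k] permutes the degrees, and each component is carried bijectively
    to its image. *)
Lemma add_aut_ring_aut a h : ring_aut a -> hom_mu h -> ring_aut (add_aut Agr a h).
Proof.
move=> ha hh; have [aD aM a1 _] := ha; have [hu hD] := hh.
have [[gD gB] aG] := alphaG_spec ha.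
have [b [hb aK bK]] := ring_aut_inv ha; have [bD bM b1 _] := hb.
pose f := add_aut Agr a h.
have fE c x : Agr c x -> f x = a x * h c by apply: add_autE.
have fD : zhom f.
  move=> x y; rewrite /f /add_aut -big_split; apply: eq_bigr => c _ /=.
  by rewrite (hcD hS) aD mulrDl.
have f1 : f 1 = 1 by rewrite (fE _ _ (gr1 hS)) a1 hom_mu0 ?mulr1.
have fM x y : f (x * y) = f x * f y.
  elim/(homog_ind hS): x => [x1 x2 IH1 IH2|c x cx].
    by rewrite mulrDl !fD IH1 IH2 mulrDl.
  elim/(homog_ind hS): y => [y1 y2 IH1 IH2|d y dy].
    by rewrite mulrDr !fD IH1 IH2 mulrDr.
  by rewrite (fE _ _ (grM hS cx dy)) (fE _ _ cx) (fE _ _ dy) aM hD mulrACA.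
pose k c := alphaG Agr a c + deg Agr (h c).
have kD : zhom k by move=> c d; rewrite /k gD (deg_hom hh) addrACA.
have k_inj : injective k.
  apply: zhom_inj0 => // c kc.
  have hb' : hom_mu (b \o h \o -%R) by apply: hom_mu_aut => // c' d'; rewrite opprD.
  apply: (deg_hom_fixed hb'); apply: (bij_inj gB).
  rewrite -alphaG_deg //=; last by case: hb' => hb' _; exact: (hb' c).
  by rewrite bK (zhomN (deg_hom hh)); apply/esym/eqP; rewrite -addr_eq0 -/(k c) kc.
have fk c x : Agr c x -> Agr (k c) (f x).
  by move=> cx; rewrite (fE c) //; apply: grM => //; [apply: (aG c x).1 | apply: degP].
split=> //; apply: (graded_bij (hcD hS) (hc_sum hS) fD k_inj) => [c x|c x|c y].
- rewrite -{1}(hc_sum hS x) zhom_sum // (zhom_sum (hcD hS (k c))) (bigD1 c) //= big1.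
    by rewrite addr0 (hc_homog hS (fk _ _ (hcP hS x c))) eqxx.
  move=> d dc; rewrite (hc_homog hS (fk _ _ (hcP hS x d))).
  by rewrite (inj_eq k_inj) eq_sym (negPf dc).
- have cx := hcP hS x c; rewrite (fE _ _ cx) => /root_of_unity_reg x0.
  by apply: (can_inj aK); rewrite [RHS]zhom0 //; apply: x0.
(* The preimage: divide by [h c], whose inverse is [h (- c)], then undo [a]. *)
exists (b (hc Agr y (k c) * h (- c))); rewrite (fE c).
  by rewrite bK -mulrA [h _ * _]mulrC hom_muN ?mulr1.
apply: (aG _ _).2; rewrite bK; have := grM hS (hcP hS y (k c)) (degP (hu (- c))).
by rewrite (zhomN (deg_hom hh)) addrK.
Qed.

End Main.

(** * The matrix group *)

Section Matrices.
Variables (A : comPzRingType) (Gam : finZmodType) (Agr : Gam -> A -> Prop).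
Variable G : finZmodType.
Hypotheses (hord : is_order A) (hred : reduced A) (hconn : connected A) (hstark : stark A)
  (huniv : universal_grading Agr).
Local Notation gring := (gring A G).
Local Notation mat := (mat A Gam G).
Implicit Types m : mat.

Let hS : is_grading Agr := proj1 huniv.

Definition mat_act m (u : gring) : gring :=
  \sum_g \sum_c gel (m_a m (hc Agr (u g) c) * m_s m g) (m_t m c + m_sig m g).

Lemma gring_homog_ind (P : gring -> Prop) :
  (forall u v, P u -> P v -> P (u + v)) -> (forall c x g, Agr c x -> P (gel x g)) ->
  forall u, P u.
Proof.
move=> PD Pg u; have P0 : P 0.
  by rewrite -(zhom0 (@gelD A G 0)); apply: Pg (gr0 hS 0).
rewrite -(gel_sum u); elim/big_ind: _ => // g _.
elim/(homog_ind hS): (u g) => [x y IHx IHy|c x cx]; last exact: Pg cx.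
by rewrite gelD; apply: PD.
Qed.

Lemma mat_actD m : zhom (m_a m) -> zhom (mat_act m).
Proof.
move=> aD u v; rewrite -big_split; apply: eq_bigr => g _ /=.
rewrite -big_split; apply: eq_bigr => c _ /=.
by rewrite ffunE (hcD hS) aD mulrDl gelD.
Qed.

Lemma mat_act_gel m c x g : zhom (m_a m) -> Agr c x ->
  mat_act m (gel x g) = gel (m_a m x * m_s m g) (m_t m c + m_sig m g).
Proof.
move=> aD cx; have a0 h d e : gel (m_a m (hc Agr 0 d) * h) e = 0 :> gring.
  by rewrite (zhom0 (hcD hS d)) (zhom0 aD) mul0r (zhom0 (@gelD _ _ e)).
rewrite /mat_act (bigD1 g) //= [X in _ + X]big1 ?addr0 => [|h /negPf hg]; last first.
  by rewrite big1 // => d _; rewrite gelE hg.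
rewrite gelE eqxx (bigD1 c) //= [X in _ + X]big1 ?addr0 => [|d /negPf dc].
  by rewrite (hc_homog hS cx) eqxx.
by rewrite (hc_homog hS cx) dc (zhom0 aD) mul0r (zhom0 (@gelD _ _ _)).
Qed.

Lemma mat_act1 m : inM m -> mat_act m 1 = 1.
Proof.
case=> [[aD _ a1 _] hs tD [sgD _]].
rewrite -gel1 (mat_act_gel _ aD (gr1 hS)) a1 (hom_mu0 hs) mulr1.
by rewrite (zhom0 tD) (zhom0 sgD) addr0.
Qed.

Lemma mat_actM m u v : inM m -> mat_act m (u * v) = mat_act m u * mat_act m v.
Proof.
case=> [[aD aM _ _] [_ sD] tD [sgD _]]; have fD := mat_actD aD.
elim/gring_homog_ind: u => [u1 u2 IH1 IH2|c x g cx].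
  by rewrite mulrDl !fD IH1 IH2 mulrDl.
elim/gring_homog_ind: v => [v1 v2 IH1 IH2|d y h dy].
  by rewrite mulrDr !fD IH1 IH2 mulrDr.
rewrite gelM (mat_act_gel _ aD (grM hS cx dy)) (mat_act_gel _ aD cx) (mat_act_gel _ aD dy).
by rewrite gelM aM sD tD sgD mulrACA addrACA.
Qed.

(** The group ring is graded by [Gam * G], and the matrix acts on these degrees through [k]. If
    [k (c, g) = 0], the second coordinate gives [g = rho (t (- c))]; substituted in the first, this
    makes [c] a fixed point to which starkness applies. *)
Lemma mat_act_bij m : inM m -> bijective (mat_act m).
Proof.
case: m => a s t sg [/= ha hs tD [sgD [rho sgK rhoK]]].
have rhoD : zhom rho by move=> g h; apply: (can_inj sgK); rewrite sgD !rhoK.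
have [aD aM a1 _] := ha; have [su sD] := hs.
have [[gD gB] aG] := alphaG_spec huniv ha.
have [b [hb aK bK]] := ring_aut_inv ha; have [bD bM b1 _] := hb.
have degD := deg_hom hord hred hconn huniv.
pose m : mat := Mat a s t sg; have fD : zhom (mat_act m) by apply: mat_actD.
pose k (p : Gam * G) : Gam * G :=
  (alphaG Agr a p.1 + deg Agr (s p.2), t p.1 + sg p.2).
have kD : zhom k by move=> p q; rewrite /k /= gD tD sgD degD // addrACA [X in (_, X)]addrACA.
have k_inj : injective k.
  apply: zhom_inj0 => // -[c g] [] /= k1 k2.
  have gE : g = rho (t (- c)).
    apply: (can_inj sgK); rewrite rhoK (zhomN tD); apply/eqP.
    by rewrite -addr_eq0 addrC k2.
  have hb' : hom_mu (b \o s \o (fun c => rho (t c))).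
    by apply: hom_mu_aut => // c' d'; rewrite tD rhoD.
  have c0 : c = 0.
    apply: (deg_hom_fixed hord hred hconn hstark huniv hb'); apply: (bij_inj gB).
    rewrite -(alphaG_deg hord hred hconn huniv) //=; last by case: hb' => hb' _; apply: (hb' c).
    rewrite bK; apply/eqP; rewrite -[c in rho (t c)]opprK (zhomN tD) (zhomN rhoD) -gE.
    by rewrite (zhomN (degD _ _ hs)) eq_sym -addr_eq0 k1.
  by rewrite c0 oppr0 in gE; rewrite c0 gE (zhom0 tD) (zhom0 rhoD).
(* Projection to the summand [A_c g], for [p = (c, g)]. *)
pose pi (p : Gam * G) (u : gring) : gring := gel (hc Agr (u p.2) p.1) p.2.
have piD p : zhom (pi p) by move=> u v; rewrite /pi ffunE (hcD hS) gelD.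
have pi_gel p c x g : Agr c x -> pi p (gel x g) = if p == (c, g) then gel x g else 0.
  case: p => d h cx; rewrite /pi /= gelE xpair_eqE.
  have [->|_] := eqVneq h g; last first.
    by rewrite andbF (zhom0 (hcD hS _)) (zhom0 (@gelD _ _ _)).
  rewrite andbT (hc_homog hS cx); case: eqP => // _.
  by rewrite (zhom0 (@gelD _ _ _)).
have fk c x g : Agr c x -> Agr (k (c, g)).1 (a x * s g).
  by move=> cx; apply: grM => //; [apply: (aG _ _).1 | apply: degP].
have pi_sum u : \sum_p pi p u = u.
  elim/gring_homog_ind: u => [u v IHu IHv|c x g cx].
    by rewrite -{2}IHu -{2}IHv -big_split; apply: eq_bigr => p _; rewrite piD.
  by under eq_bigr do rewrite (pi_gel _ _ _ _ cx); rewrite -big_mkcond big_pred1_eq.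
apply: (graded_bij piD pi_sum fD k_inj) => [p u|[c g] u|[c g] u].
- elim/gring_homog_ind: u => [u v IHu IHv|c x g cx].
    by rewrite piD !fD piD IHu IHv.
  rewrite (pi_gel _ _ _ _ cx) (mat_act_gel _ _ cx) //= (pi_gel _ _ _ _ (fk c x g cx)).
  rewrite -[(_, _)]/(k (c, g)) (inj_eq k_inj).
  by case: eqP => _; rewrite ?(mat_act_gel _ _ cx) // (zhom0 fD).
- rewrite {1}/pi /= (mat_act_gel _ _ (hcP hS _ c)) //= /pi /= => /(congr1 (@augm A G)).
  rewrite augm_gel (zhom0 (@augmD A G)) => /(root_of_unity_reg (su g)) x0.
  suff -> : hc Agr (u g) c = 0 by rewrite (zhom0 (@gelD _ _ _)).
  by apply: (can_inj aK); rewrite x0 (zhom0 aD).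
pose z := hc Agr (u (k (c, g)).2) (k (c, g)).1.
exists (gel (b (z * s (- g))) g); rewrite (@mat_act_gel m c) //=.
  by rewrite bK -mulrA [s _ * _]mulrC hom_muN ?mulr1.
apply: (aG _ _).2; rewrite bK.
have := grM hS (hcP hS (u (k (c, g)).2) (k (c, g)).1) (degP hord hred hconn huniv (su (- g))).
by rewrite (zhomN (degD _ _ hs)) /= addrK.
Qed.

Lemma mat_act_gr_aut m : inM m -> gr_aut (mat_act m).
Proof.
move=> hm; split; [|exact: (fun u v => mat_actM u v hm)|exact: mat_act1|exact: mat_act_bij].
by apply: mat_actD; case: hm => [[]].
Qed.

(** The upper left entry is covered by [add_aut_ring_aut]. For the lower right one, an element [g]
    of the kernel satisfies [g = r (deg Agr (s2 g))], so the degree of [s2 g] is a fixed point and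
    vanishes by starkness; hence [g = 0]. *)
Lemma inM_mulM m1 m2 : inM m1 -> inM m2 -> inM (mulM Agr m1 m2).
Proof.
case: m1 m2 => [a1 s1 t1 g1] [a2 s2 t2 g2].
move=> [/= ha1 hs1 tD1 [gD1 [r1 g1K r1K]]] [/= ha2 hs2 tD2 [gD2 [r2 g2K r2K]]].
have [a1D a1M a11 a1B] := ha1; have [a2D a2M a21 a2B] := ha2.
have [s1u s1D] := hs1; have [s2u s2D] := hs2.
have [[aGD _] _] := alphaG_spec huniv ha2.
have degD := deg_hom hord hred hconn huniv.
split=> /=.
- apply: add_aut_ring_aut => //; first split=> /= [x y|x y||].
  + by rewrite a2D a1D.
  + by rewrite a2M a1M.
  + by rewrite a21.
  + exact: bij_comp.
  by split=> [c|c d] /=; rewrite ?tD2.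
- split=> [g|g h]; last by rewrite s2D a1M gD2 s1D mulrACA.
  by apply: root_of_unityM => //; apply: root_of_unity_morph.
- by move=> c d; rewrite aGD tD1 tD2 gD1 addrACA.
apply: zaut_inj => [g h|]; first by rewrite degD // tD1 gD2 gD1 addrACA.
apply: zhom_inj0 => [g h|g g0]; first by rewrite degD // tD1 gD2 gD1 addrACA.
pose r c := r2 (r1 (t1 (- c))).
have rD : zhom r.
  move=> c d; apply: (can_inj g2K); apply: (can_inj g1K).
  by rewrite /r gD2 gD1 !r2K !r1K opprD tD1.
have hr : hom_mu (s2 \o r) by split=> [c|c d] /=; rewrite ?rD.
have gE : g = r (deg Agr (s2 g)).
  apply: (can_inj g2K); apply: (can_inj g1K); rewrite /r r2K r1K (zhomN tD1).
  by apply/eqP; rewrite -addr_eq0 addrC g0.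
have d0 : deg Agr (s2 g) = 0.
  by apply: (deg_hom_fixed hord hred hconn hstark huniv hr); rewrite /= -gE.
by rewrite gE d0 (zhom0 rD).
Qed.

(** For [x] of degree [c], the coefficient of the image of [x g] under [m2] has degree [alphaG Agr
    (m_a m2) c + deg Agr (m_s m2 g)]. Applying [m_t m1] to this sum produces the terms with [alphaG]
    and [deg] in the second row of the product. *)
Lemma mat_act_mulM m1 m2 u : inM m1 -> inM m2 ->
  mat_act (mulM Agr m1 m2) u = mat_act m1 (mat_act m2 u).
Proof.
move=> h1 h2; have [[a12D _ _ _] _ _ _] := inM_mulM h1 h2.
case: h1 h2 => [[a1D a1M _ _] [_ s1D] t1D [g1D _]] [ha2 [s2u _] _ _].
have [a2D _ _ _] := ha2.
elim/gring_homog_ind: u => [u v IHu IHv|c x g cx].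
  by rewrite !mat_actD // IHu IHv.
rewrite (mat_act_gel _ a12D cx) (mat_act_gel _ a2D cx) /=.
have ds := degP hord hred hconn huniv (s2u g).
have ax := ((alphaG_spec huniv ha2).2 c x).1 cx.
rewrite (mat_act_gel _ a1D (grM hS ax ds)) (add_autE huniv _ _ cx) //=; last first.
  by move=> y z /=; rewrite a2D a1D.
by rewrite a1M s1D t1D g1D mulrACA addrACA.
Qed.

(** The images of [1 g] determine the entries on [G], and the augmentations of the images of [x 0]
    determine the ring automorphism. The remaining entry is then known on degrees of nonzero
    components, which generate [Gam]. *)
Lemma mat_act_inj m1 m2 : inM m1 -> inM m2 -> mat_act m1 =1 mat_act m2 -> m1 = m2.
Proof.
move=> h1 h2 e12; case: m1 m2 h1 h2 e12 => [a1 s1 t1 g1] [a2 s2 t2 g2].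
move=> [/= ha1 hs1 tD1 [gD1 _]] [/= ha2 hs2 tD2 [gD2 _]] e12.
have [a1D _ a11 a1B] := ha1; have [a2D _ a21 _] := ha2.
have eg c x g : Agr c x ->
    gel (a1 x * s1 g) (t1 c + g1 g) = gel (a2 x * s2 g) (t2 c + g2 g).
  by move=> cx; have := e12 (gel x g); rewrite !(mat_act_gel _ _ cx).
have esg g : s1 g = s2 g /\ g1 g = g2 g.
  have := eg _ _ g (gr1 hS).
  rewrite a11 a21 (zhom0 tD1) (zhom0 tD2) !add0r !mul1r => /gel_eq; apply.
  by apply: root_of_unity_neq0 => //; case: hs1.
have ext (U V : Type) (f f' : U -> V) : f =1 f' -> f = f'.
  exact: functional_extensionality.
have -> : a1 = a2.
  apply: ext; elim/(homog_ind hS) => [x y IHx IHy|c x cx]; first by rewrite a1D a2D IHx IHy.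
  have /(congr1 (@augm A G)) := eg _ _ 0 cx.
  by rewrite !augm_gel (hom_mu0 hs1) (hom_mu0 hs2) !mulr1.
have -> : s1 = s2 by apply: ext => g; case: (esg g).
have -> : g1 = g2 by apply: ext => g; case: (esg g).
suff -> : t1 = t2 by [].
apply: ext; apply: (universal_generate huniv) => // c x cx x0.
have /gel_eq := eg _ _ 0 cx; rewrite (zhom0 gD1) (zhom0 gD2) !addr0 => -[] //.
rewrite (hom_mu0 hs1) mulr1 => ax; apply: x0; apply: (bij_inj a1B).
by rewrite ax (zhom0 a1D).
Qed.

(** * Matrix form of the automorphisms of the group ring *)

Lemma root_of_unity_gring (z : gring) : root_of_unity z ->
  exists x g, root_of_unity x /\ z = gel x g.
Proof.
move=> hz; have [A01 hidem] := hconn.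
have [||g /gr_gradingP zE] := root_of_unity_homog (gring_is_order G hord)
  (gring_reduced hord hred) (gr_grading_is_grading A G) _ _ hz.
- by move=> /(congr1 (@augm A G)); rewrite (zhom0 (@augmD A G)) -gel1 augm_gel.
(* The degree 0 part is a copy of [A], whose idempotents are 0 and 1 by connectedness. *)
- move=> e /gr_gradingP ->; rewrite gelM addr0 => /gel_inj /hidem[->|->].
    by left; rewrite (zhom0 (@gelD _ _ _)).
  by right.
exists (z g), g; split=> //.
rewrite -(augm_gel (z g) g) -zE.
by apply: root_of_unity_morph hz; [exact: augmM | rewrite -gel1 augm_gel].
Qed.

(** The product of [gring] is [gmul], so this holds by conversion. *)
Lemma gr_autP (F : gring -> gring) : gr_aut F ->
  [/\ zhom F, forall u v, F (u * v) = F u * F v, F 1 = 1 & bijective F].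
Proof. by []. Qed.

Lemma gr_aut_decomp (F : gring -> gring) : gr_aut F ->
  exists m, [/\ [/\ zhom (m_a m), forall x y, m_a m (x * y) = m_a m x * m_a m y & m_a m 1 = 1],
    hom_mu (m_s m), zhom (m_t m), zhom (m_sig m) & F =1 mat_act m].
Proof.
move=> /gr_autP[FD FM F1 FB]; have hR := gr_grading_is_grading A G.
have [sg sgP] : exists sg : G -> A * G, forall g,
    root_of_unity (sg g).1 /\ F (gel 1 g) = gel (sg g).1 (sg g).2.
  apply: (ClassicalEpsilon.choice (fun g p => root_of_unity p.1 /\ F (gel 1 g) = gel p.1 p.2)) => g.
  have [x [h [hx e]]] : exists x h, root_of_unity x /\ F (gel 1 g) = gel x h.
    apply: root_of_unity_gring; apply: root_of_unity_morph => //.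
    by apply: root_of_unity_gel; exists 1%N; rewrite expr1n.
  by exists (x, h).
pose s g := (sg g).1; pose si g := (sg g).2.
have Fg g : F (gel 1 g) = gel (s g) (si g) by case: (sgP g).
have su g : root_of_unity (s g) by case: (sgP g).
have ssiD g h : s (g + h) = s g * s h /\ si (g + h) = si g + si h.
  have := FM (gel 1 g) (gel 1 h); rewrite gelM mulr1 !Fg gelM => /gel_eq; apply.
  exact: root_of_unity_neq0.
(* The [G]-grading pulled back along [F] and restricted to the copy of [A] in the group ring. That
   its parts span [A] is what the common refinement provides. *)
pose T h x := gr_grading h (F (gel x 0)).
have FgD : zhom (fun x => F (gel x 0)) by move=> x y; rewrite gelD FD.
have hT : is_grading T.
  have hT' := pullback_grading FD FM FB hR.
  apply: grading_fin => [h|g h x y Tx Ty|x|c Tc c0 h].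
  - split=> [|x y Tx Ty]; rewrite /T; first by rewrite (zhom0 FgD); apply: (gr0 hR).
    by rewrite (zhomB FgD); apply: (grB hR).
  - have := grM hR Tx Ty; by rewrite -FM gelM addr0.
  - have [y [yP xE]] :=
      common_refinement (gring_is_order G hord) (gring_reduced hord hred) hR hT' (gel x 0).
    (* Of the bihomogeneous parts, those of [G]-degree 0 lie in the copy of [A]; their coefficients
       at 0 are the components of [x]. *)
    exists (fun h => y 0 h 0); split=> [h|].
      by rewrite /T; have [/gr_gradingP <-] := yP 0 h.
    have := congr1 (fun u : gring => u 0) xE; rewrite gelE eqxx => ->.
    rewrite sum_ffunE (bigD1 0) //= [X in _ + X]big1 ?addr0 => [|g g0].
      by rewrite sum_ffunE.
    by rewrite sum_ffunE big1 // => h _; apply: (yP g h).1; rewrite eq_sym.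
  have Fc := gr_indep hR (c := fun h => F (gel (c h) 0)) Tc _ h.
  apply: (@gel_inj _ _ 0); apply: (bij_inj FB).
  rewrite Fc; first by rewrite (zhom0 FgD).
  by rewrite -(zhom_sum FgD) c0 (zhom0 FgD).
have [t tD tT] := universal_hom huniv hT.
(* For [x] of degree [c] the image has a single coefficient, at [t c], and the augmentation reads it
   off multiplicatively. *)
pose al x := augm (F (gel x 0)).
have alD : zhom al by move=> x y; rewrite /al FgD augmD.
have alM x y : al (x * y) = al x * al y.
  by rewrite /al -augmM -FM gelM addr0.
have al1 : al 1 = 1 by rewrite /al gel1 F1 -gel1 augm_gel.
exists (Mat al s t si); split=> //.
- by split=> // g h; case: (ssiD g h).
- by move=> g h; case: (ssiD g h).
have mD : zhom (mat_act (Mat al s t si)) by apply: mat_actD.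
elim/gring_homog_ind => [u v IHu IHv|c x g cx]; first by rewrite FD mD IHu IHv.
rewrite (mat_act_gel _ _ cx) //=.
have -> : gel x g = gel x 0 * gel 1 g by rewrite gelM mulr1 add0r.
have /gr_gradingP FE := tT c x cx; rewrite FM Fg {1}FE gelM /al; congr (gel (_ * _) _).
by rewrite [in RHS]FE augm_gel.
Qed.

(** The entries are only endomorphisms here. Comparing coefficients in [m m' = 1], the composite
    [m_a m \o m_a m'] multiplies degree [c] by the inverse of [m_s m (m_t m' c)], so it is an
    automorphism [id + h]. A [g] killed by the other composite equals [m_t m (deg Agr (m_s m' g))],
    so the degree of [m_s m' g] is a fixed point, hence 0. *)
Lemma mat_act_comp_id m m' :
  [/\ zhom (m_a m), forall x y, m_a m (x * y) = m_a m x * m_a m y & m_a m 1 = 1] ->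
  [/\ zhom (m_a m'), forall x y, m_a m' (x * y) = m_a m' x * m_a m' y & m_a m' 1 = 1] ->
  hom_mu (m_s m) -> hom_mu (m_s m') -> zhom (m_t m) -> zhom (m_t m') ->
  zhom (m_sig m) -> zhom (m_sig m') -> (forall u, mat_act m (mat_act m' u) = u) ->
  bijective (m_a m \o m_a m') /\ injective (m_sig m \o m_sig m').
Proof.
case: m m' => [a s t si] [a' s' t' si'] /= [aD aM a1] [aD' aM' a1'] hs hs' tD tD' siD siD' mm'.
split.
  have aug y h : augm (mat_act (Mat a s t si) (gel y h)) = a y * s h.
    elim/(homog_ind hS): y => [y z IHy IHz|d y dy].
      by rewrite gelD mat_actD // augmD IHy IHz aD mulrDl.
    by rewrite (mat_act_gel _ _ dy) // augm_gel.
  have aa c x : Agr c x -> a (a' x) * s (t' c) = x.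
    move=> cx; rewrite -aug -[RHS](@augm_gel A G x 0) -(mm' (gel x 0)).
    by rewrite (mat_act_gel _ _ cx) //= (hom_mu0 hs') mulr1 (zhom0 siD') addr0.
  have hh : hom_mu (id \o s \o (fun c => t' (- c))).
    by apply: hom_mu_aut => // c d; rewrite opprD tD'.
  have hid : ring_aut (@id A) by split=> //; exists id.
  have [fD _ _ fB] := add_aut_ring_aut hord hred hconn hstark huniv hid hh.
  apply: (eq_bij fB) => x; elim/(homog_ind hS): x => [x y IHx IHy|c x cx].
    by rewrite fD IHx IHy /= aD' aD.
  rewrite (add_autE huniv _ _ cx) //= -{1}(aa c x cx) -mulrA (zhomN tD').
  by rewrite hom_muN ?mulr1.
have degD := deg_hom hord hred hconn huniv.
have [su sD] := hs'.
have key g : t (deg Agr (s' g)) + si (si' g) = g.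
  have := mm' (gel 1 g); rewrite (mat_act_gel _ _ (gr1 hS)) //= a1' mul1r (zhom0 tD') add0r.
  rewrite (mat_act_gel _ _ (degP hord hred hconn huniv (su g))) //=.
  by move=> /esym /gel_eq[]; [exact: (A1_neq0 hconn) | move=> _ /esym].
apply: zhom_inj0 => [g h|g /= g0]; first by rewrite /= siD' siD.
have gE : t (deg Agr (s' g)) = g by rewrite -[RHS]key g0 addr0.
have hh : hom_mu (s' \o t) by split=> [c|c d] /=; rewrite ?tD.
have d0 : deg Agr (s' g) = 0.
  by apply: (deg_hom_fixed hord hred hconn hstark huniv hh); rewrite /= gE.
by rewrite -gE d0 (zhom0 tD).
Qed.

Lemma gr_aut_inv (F : gring -> gring) : gr_aut F ->
  exists F' : gring -> gring, [/\ gr_aut F', cancel F F' & cancel F' F].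
Proof.
by move=> /gr_autP hF; exact: (ring_aut_inv hF).
Qed.

(** With the matrices of [F] and of its inverse composed in both orders, one order makes the ring
    entry surjective and the other makes it injective. On the finite [G] injectivity is enough. *)
Lemma mat_act_surj (F : gring -> gring) : gr_aut F -> exists2 m, inM m & mat_act m =1 F.
Proof.
move=> hF; have [F' [hF' FK F'K]] := gr_aut_inv hF.
have [m [ha hs tD siD Fm]] := gr_aut_decomp hF.
have [m' [ha' hs' tD' siD' Fm']] := gr_aut_decomp hF'.
have mm' u : mat_act m (mat_act m' u) = u by rewrite -Fm' -Fm F'K.
have m'm u : mat_act m' (mat_act m u) = u by rewrite -Fm -Fm' FK.
have [aa' _] := mat_act_comp_id ha ha' hs hs' tD tD' siD siD' mm'.
have [a'a sisi] := mat_act_comp_id ha' ha hs' hs tD' tD siD' siD m'm.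
exists m => [|u]; last by rewrite Fm.
split=> //; last by apply: zaut_inj => //; apply: inj_compr sisi.
have [aD aM a1] := ha; split=> //.
apply: inj_surj_bij => [|y]; first exact: inj_compr (bij_inj a'a).
by have [f _ fK] := aa'; exists (m_a m' (f y)); apply: fK.
Qed.

Definition mat1 : mat := Mat id (fun=> 1) (fun=> 0) id.

Lemma inM_mat1 : inM mat1.
Proof.
split=> /=; first by split=> //; exists id.
- by split=> [g|g h]; [exists 1%N; rewrite expr1n | rewrite mulr1].
- by move=> c d; rewrite addr0.
by split=> //; exists id.
Qed.

Lemma mat_act_mat1 u : mat_act mat1 u = u.
Proof.
elim/gring_homog_ind: u => [u v IHu IHv|c x g cx].
  by rewrite mat_actD // IHu IHv.
by rewrite (mat_act_gel _ _ cx) //= mulr1 add0r.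
Qed.

(** Every identity is tested on the faithful action; the inverse of a matrix is the one representing
    the inverse automorphism. *)
Lemma mat_group : is_group (@inM A Gam G) (@mulM A Gam Agr G).
Proof.
split; first exact: inM_mulM.
  move=> x y z hx hy hz; apply: mat_act_inj; try by do ?apply: inM_mulM.
  by move=> u; rewrite !mat_act_mulM //; apply: inM_mulM.
exists mat1; split; first exact: inM_mat1.
  move=> m hm; have h1 := inM_mat1.
  split; apply: mat_act_inj => //; try exact: inM_mulM.
    by move=> u; rewrite mat_act_mulM ?mat_act_mat1.
  by move=> u; rewrite mat_act_mulM ?mat_act_mat1.
move=> m hm; have [F' [hF' FK F'K]] := gr_aut_inv (mat_act_gr_aut hm).
have [m' hm' mF'] := mat_act_surj hF'; have h1 := inM_mat1.
exists m'; split=> //; apply: mat_act_inj => //; try exact: inM_mulM.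
- by move=> u; rewrite mat_act_mulM // mF' F'K mat_act_mat1.
- by move=> u; rewrite mat_act_mulM // mF' FK mat_act_mat1.
Qed.

End Matrices.

Theorem theorem1p5 (A : comPzRingType) (Gam : finZmodType) (Agr : Gam -> A -> Prop)
  (G : finZmodType)
  (hord : is_order A) (hred : reduced A) (hconn : connected A) (hstark : stark A)
  (huniv : universal_grading Agr) :
  is_group (@inM A Gam G) (@mulM A Gam Agr G)
  /\ exists Phi : mat A Gam G -> ({ffun G -> A} -> {ffun G -> A}),
      [/\ forall m, inM m -> gr_aut (Phi m),
          forall m1 m2, inM m1 -> inM m2 ->
            forall u, Phi (@mulM A Gam Agr G m1 m2) u = Phi m1 (Phi m2 u),
          forall m1 m2, inM m1 -> inM m2 -> (forall u, Phi m1 u = Phi m2 u) -> m1 = m2,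
          forall F, gr_aut F -> exists2 m, inM m & forall u, Phi m u = F u &
          forall m, inM m -> forall (g : G) (c : Gam) (x : A), Agr c x ->
            Phi m (gelt x g) = gelt (m_a m x * m_s m g) (m_t m c + m_sig m g)].
Proof.
split; first exact: mat_group.
exists (@mat_act A Gam Agr G); split.
- exact: mat_act_gr_aut.
- by move=> m1 m2 h1 h2 u; apply: mat_act_mulM.
- exact: mat_act_inj.
- exact: mat_act_surj.
by move=> m [[aD _ _ _] _ _ _] g c x; apply: mat_act_gel.
Qed.
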